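(* The admissible algebras $\mathcal N$ of nil-index $3$ are, up to isomorphism, precisely the smash products $\mathcal N'\vee\mathcal N''$, where $\mathcal N'$ is a reduced algebra of dimension $>1$ of type (C) (described in the context) and $\mathcal N''$ is an admissible algebra of nil-index at most two. If $\mathcal N$ has Hilbert function $\{1,m,n,1\}$ then $\mathcal N'$ has symmetric Hilbert function $\{1,n,n,1\}$ and admits a canonical grading. Furthermore, the Hilbert function of $\mathcal N''$ is $\{1,m-n,1\}$ if $m>n$, and is $\{1,1\}$ if $m=n$ (that is, $\dim(\mathcal N'')=1$, or equivalently, $\mathcal N=\mathcal N'$ in this case).
   Context: $\mathbb F$ is a field of characteristic $0$; all algebras are associative $\mathbb F$-algebras. For an algebra $\mathcal N$ put $\mathcal N^1=\mathcal N$ and let $\mathcal N^{k+1}$ be the linear span of $\mathcal N\mathcal N^k$; $\mathcal N$ is nilpotent if $\mathcal N^{k+1}=0$ for some $k\ge0$, and the minimal such $k$ is the nil-index $\nu(\mathcal N)$. An admissible algebra is a commutative nilpotent algebra $\mathcal N$ of finite dimension over $\mathbb F$ whose annihilator $\mathcal N_{[1]}=\{x:x\mathcal N=0\}$ has dimension $1$. Hilbert function: $H(0)=1$ and $H(k)=\dim(\mathcal N^k/\mathcal N^{k+1})$ for $k\ge1$, written as the finite sequence $\{H(0),H(1),\dots,H(\nu)\}$, $\nu=\nu(\mathcal N)$; it is symmetric if $H(k)=H(\nu-k)$ for $0\le k\le\nu$. Canonical grading: a decomposition $\mathcal N=\bigoplus_{k>0}\mathcal N_k$ with $\mathcal N_k=\phi^{-1}(\mathcal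 N^k/\mathcal N^{k+1})$ for an algebra isomorphism $\phi$ from $\mathcal N$ onto the graded algebra $\mathrm{gr}(\mathcal N)=\bigoplus_{k>0}\mathcal N^k/\mathcal N^{k+1}$ (with product of $x+\mathcal N^{j+1}$ and $y+\mathcal N^{k+1}$ equal to $xy+\mathcal N^{j+k+1}$ for $x\in\mathcal N^j$, $y\in\mathcal N^k$). Pointing and smash product: a pointing on an admissible algebra $\mathcal N$ is a linear form $\omega:\mathcal N\to\mathbb F$ with $\omega(\mathcal N_{[1]})=\mathbb F$. For admissible algebras with pointings $(\mathcal N',\omega')$, $(\mathcal N'',\omega'')$ the set $\mathcal I=\{(s,t)\in\mathcal N'_{[1]}\times\mathcal N''_{[1]}:\omega'(s)+\omega''(t)=0\}$ is an ideal in $\mathcal N'\times\mathcal N''$, and the smash product is $\mathcal N'\vee\mathcal N'':=(\mathcal N'\times\mathcal N'')/\mathcal I$, with pointing $(s,t)+\mathcal I\mapsto\omega'(s)+\omega''(t)$. An admissible algebra is reduced if it is not isomorphic to a smash product $\mathcal N_1\vee\mathcal N_2$ with $\nu(\mathcal N_2)=2$. Nil-polynomials: for a finite-dimensional vector space $W$, $\mathbf p\in\mathbb F[W]$ is a nil-polynomial associated to the admissible algebra $\mathcal N$ if $\mathbf p=\omega\circ\exp_2\circ\phi$ for a pointing $\omega$ on $\mathcal N$ and a linear isomorphism $\phi:W\to\ker\omega$, where $\exp_2(x)=\sum_{k\ge2}x^k/k!$. Type (C): a reduced algebra of dimension $>1$ is of type (C) if it has an associated nil-polynomial of the form $\mathbf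 q+\mathbf c$ on a vector space $W=W_1\oplus W_2\neq0$ of finite dimension, where $\mathbf q$ is a non-degenerate quadratic form on $W$, $W_1,W_2$ are totally isotropic with respect to $\mathbf q$, and $\mathbf c$ is a cubic form on $W_1$ extended to $W$ by $\mathbf c(x+y)=\mathbf c(x)$ for $x\in W_1,y\in W_2$. (For such algebras, being reduced is equivalent to $\mathbf c$ being non-degenerate on $W_1$, i.e. $\{a\in W_1:\mathbf c(x+a)=\mathbf c(x)\ \forall x\in W_1\}=0$.) *)

(* Defs.v *)
From HB Require Import structures.
From mathcomp Require Import all_boot all_order all_algebra.
From mathcomp Require Import mpoly.

Set Implicit Arguments.
Unset Strict Implicit.
Unset Printing Implicit Defensive.

Import GRing.Theory.
Local Open Scope ring_scope.

(* Finite-dimensional algebras without unit. Associativity and commutativity  *)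
(* are not part of the structure; both are required in [admissible].          *)
Record alg (F : fieldType) := Alg {
  alg_sort :> vectType F;
  amul : {bilinear alg_sort -> alg_sort -> alg_sort}
}.
Arguments amul {F a}.

Section Algebras.
Variables (F : fieldType) (A : alg F).
Implicit Types (x y : A) (U V W : {vspace A}).

Definition aprodv U V : {vspace A} :=
  <<[seq amul x y | x <- vbasis U, y <- vbasis V]>>%VS.

(* The power A^k, for k >= 1; apow 0 is a junk value. *)
Definition apow (k : nat) : {vspace A} := iter k.-1 (aprodv fullv) fullv.

Definition nilpotent := exists k : nat, apow k.+1 = 0%VS.

(* The least k with A^(k+1) = 0, see [nilindexP]. In a nilpotent algebra it   *)
(* is at most dim A; the value is meaningful for nilpotent algebras only.     *)
Definition nilindex : nat :=
  find (fun k => apow k.+1 == 0%VS) (iota 0 (\dim {:A}).+1).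

Definition ann : {vspace A} :=
  (\bigcap_(y <- vbasis {:A}) lker (linfun (applyr amul y)))%VS.

Definition admissible : Prop :=
  [/\ associative (@amul F A), commutative (@amul F A),
      nilpotent & \dim ann = 1%N].

Definition xpow x (k : nat) : A := iter k.-1 (amul x) x.

(* exp_2; the terms of the series with k > nilindex vanish. *)
Definition exp2 x : A :=
  \sum_(2 <= k < nilindex.+1) (k`!%:R : F)^-1 *: xpow x k.

Definition pointing (w : 'Hom(A, F^o)) : Prop := (w @: ann)%VS = fullv.

Lemma amul0l y : amul (0 : A) y = 0.
Proof. exact: linear0l. Qed.

Lemma amul0r x : amul x (0 : A) = 0.
Proof. exact: linear0r. Qed.

Lemma amulBB x x' y y' :
  amul x' y' - amul x y = amul (x' - x) y' + amul x (y' - y).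
Proof. by rewrite linearBl linearBr addrA subrK. Qed.

Lemma aprodvP U V W :
  reflect (forall x y, x \in U -> y \in V -> amul x y \in W)
          (aprodv U V <= W)%VS.
Proof.
apply: (iffP idP) => [sUV x y Ux Vy | sUV].
  rewrite (coord_vbasis Ux) linear_sumlz memv_suml // => i _.
  rewrite (coord_vbasis Vy) linear_sumr memv_suml // => j _.
  rewrite linearZl_LR linearZr_LR /= !memvZ //= (subvP sUV) // memv_span //.
  by apply: allpairs_f; rewrite mem_nth // size_tuple.
apply/span_subvP => _ /allpairsP[[x y] /= [/vbasis_mem Ux /vbasis_mem Vy ->]].
exact: sUV.
Qed.

Lemma memv_aprodv U V x y : x \in U -> y \in V -> amul x y \in aprodv U V.
Proof. by apply/aprodvP: x y. Qed.

Lemma annP x : reflect (forall y, amul x y = 0) (x \in ann).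
Proof.
have memE (s : seq A) :
    (x \in \bigcap_(y <- s) lker (linfun (applyr amul y)))%VS
    = all (fun y => amul x y == 0) s.
  elim: s => [|y s IH]; first by rewrite big_nil memvf.
  by rewrite big_cons memv_cap IH memv_ker lfunE.
rewrite /ann memE; apply: (iffP allP) => [x0 y | x0 y _]; last by rewrite x0.
rewrite (coord_vbasis (memvf y)) linear_sumr big1 // => i _.
rewrite linearZr_LR /=.
by rewrite (eqP (x0 _ _)) ?scaler0 // mem_nth // size_tuple.
Qed.

Lemma apowS k : apow k.+2 = aprodv fullv (apow k.+1).
Proof. by []. Qed.

Lemma apow_sub k l : (k <= l)%N -> (apow l <= apow k)%VS.
Proof.
have step m : (apow m.+1 <= apow m)%VS.
  case: m => [|m]; first exact: subvv.
  elim: m => [|m IH]; first exact: subvf.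
  rewrite apowS; apply/aprodvP => x y _ my.
  by rewrite memv_aprodv ?memvf //; apply: subvP my.
move=> /subnK <-; elim: (l - k)%N => [|m IH]; first exact: subvv.
by rewrite addSn (subv_trans (step _)).
Qed.

Lemma nilindexP : nilpotent ->
  apow nilindex.+1 = 0%VS /\ (forall k, apow k.+1 = 0%VS -> (nilindex <= k)%N).
Proof.
case=> n An0; set p := fun k => apow k.+1 == 0%VS.
have dec k : apow k.+1 = 0%VS \/ (\dim (apow k.+1) + k <= \dim {:A})%N.
  elim: k => [|k [IH|IH]]; first by right; rewrite addn0.
    by left; apply/eqP; rewrite -subv0 -IH apow_sub.
  have /subvP sAk := apow_sub (leqnSn k.+1).
  have [eqA|neqA] := eqVneq (apow k.+2) (apow k.+1).
    left; rewrite eqA.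
    have st m : apow (m + k).+1 = apow k.+1.
      elim: m => // m IHm; rewrite addSn apowS IHm.
      by rewrite -[RHS]eqA apowS.
    have := apow_sub (leq_addr k n.+1); rewrite addSn st An0 subv0.
    by move/eqP.
  right; rewrite addnS; apply: leq_trans IH; rewrite ltn_add2r.
  have := apow_sub (leqnSn k.+1) => sA.
  rewrite ltn_neqAle dimvS // andbT.
  by apply: contraNneq neqA => dA; rewrite eqEdim sA dA leqnn.
have hasp : has p (iota 0 (\dim {:A}).+1).
  have [k le_k pk] : exists2 k, (k <= \dim {:A})%N & p k.
    exists (\dim {:A}) => //; rewrite /p; have [->//|] := dec (\dim {:A}).
    by rewrite -[X in (_ <= X)%N]add0n leq_add2r leqn0 dimv_eq0.
  by apply/hasP; exists k; rewrite // mem_iota.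
have lt_nu := hasp; rewrite has_find size_iota in lt_nu.
split.
  by have := nth_find 0%N hasp; rewrite nth_iota // => /eqP.
move=> k /eqP pk; rewrite leqNgt; apply/negP => lt_k.
have := before_find 0%N lt_k.
by rewrite nth_iota ?(ltn_trans lt_k) // add0n pk.
Qed.

End Algebras.

(* Quotient of a finite-dimensional vector space by a subspace U, realised on *)
(* the chosen complement U^C. The class map [vcls U] is the projection along  *)
(* U; it is onto and has kernel U ([vclsK], [vcls_eq0]).                      *)
Section Quotient.
Variables (F : fieldType) (V : vectType F) (U : {vspace V}).

Definition vquot : vectType F := subvs_of (U^C)%VS.

Definition vcls : 'Hom(V, vquot) :=
  (linfun (vsproj (U^C)) \o daddv_pi (U^C) U)%VF.

Definition vrepr (u : vquot) : V := vsval u.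

Lemma vreprP a : {morph vrepr : u v / a *: u + v}.
Proof. by []. Qed.

Lemma vclsK : cancel vrepr vcls.
Proof.
move=> u; rewrite /vcls comp_lfunE lfunE /= daddv_pi_id ?vsvalK //.
  by rewrite capvC capv_compl.
exact: subvsP.
Qed.

Lemma vcls_eq0 x : (vcls x == 0) = (x \in U).
Proof.
have dUC : (U^C :&: U = 0)%VS by rewrite capvC capv_compl.
have xE : daddv_pi (U^C)%VS U x + daddv_pi U (U^C)%VS x = x.
  by apply: daddv_pi_add => //; rewrite addvC addv_complf memvf.
rewrite /vcls comp_lfunE lfunE /=; apply/eqP/idP => [x0 | Ux].
  rewrite -xE -[X in X + _](vsprojK (memv_pi (U^C)%VS U x)) x0.
  by rewrite [vsval 0]linear0 add0r memv_pi.
have : daddv_pi (U^C)%VS U x = 0.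
  apply/eqP; rewrite -memv0 -dUC memv_cap memv_pi /=.
  by rewrite -[X in X \in _](addrK (daddv_pi U (U^C)%VS x)) xE memvB ?memv_pi.
by move->; rewrite linear0.
Qed.

Lemma vreprK x : vrepr (vcls x) - x \in U.
Proof. by rewrite -vcls_eq0 linearB /= vclsK subrr. Qed.

End Quotient.

Section QuotientAlgebra.
Variables (F : fieldType) (A : alg F) (I : {vspace A}).

Definition quot_mul (u v : vquot I) : vquot I :=
  vcls I (amul (vrepr u) (vrepr v)).

Fact quot_mul_bilinear : bilinear_for *:%R *:%R quot_mul.
Proof.
by split=> w a u v; rewrite /quot_mul vreprP ?linearPl ?linearPr linearP.
Qed.

HB.instance Definition _ :=
  bilinear_isBilinear.Build F _ _ _ *:%R *:%R quot_mul quot_mul_bilinear.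

(* The algebra A / I; of interest when I is a two-sided ideal. *)
Definition quot_alg : alg F := @Alg F (vquot I) quot_mul.

Lemma vcls_mul :
    (forall x y, y \in I -> amul x y \in I) ->
    (forall x y, x \in I -> amul x y \in I) ->
  forall x y : A, vcls I (amul x y) = @amul F quot_alg (vcls I x) (vcls I y).
Proof.
move=> Il Ir x y; rewrite /amul /= /quot_mul; apply/esym/eqP.
rewrite -subr_eq0 -linearB /= vcls_eq0.
have Ix := vreprK I x; have Iy := vreprK I y.
by rewrite amulBB; apply: memvD; [apply: Ir | apply: Il].
Qed.

End QuotientAlgebra.

Section ProductAlgebra.
Variables (F : fieldType) (A B : alg F).

Definition prod_mul (u v : (A * B)%type) : (A * B)%type :=
  (amul u.1 v.1, amul u.2 v.2).

Fact prod_mul_bilinear : bilinear_for *:%R *:%R prod_mul.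
Proof.
by split=> w a u v; rewrite /prod_mul /= ?linearPl ?linearPr.
Qed.

HB.instance Definition _ :=
  bilinear_isBilinear.Build F _ _ _ *:%R *:%R prod_mul prod_mul_bilinear.

Definition prod_alg : alg F := @Alg F (A * B)%type prod_mul.

Variables (wA : 'Hom(A, F^o)) (wB : 'Hom(B, F^o)).

Definition smash_ideal : {vspace prod_alg} :=
  (linfun (fst : prod_alg -> A) @^-1: ann A
   :&: linfun (snd : prod_alg -> B) @^-1: ann B
   :&: lker ((wA \o linfun (fst : prod_alg -> A))%VF
             + (wB \o linfun (snd : prod_alg -> B))%VF)%R)%VS.

Lemma mem_smash_ideal (s : A) (t : B) :
  ((s, t) \in smash_ideal) =
    [&& s \in ann A, t \in ann B & wA s + wB t == 0].
Proof.
rewrite /smash_ideal !memv_cap -!memv_preim memv_ker.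
by rewrite add_lfunE !comp_lfunE !lfunE /= andbA.
Qed.

Lemma smash_ideal_mul0 (u v : prod_alg) :
    commutative (@amul F A) -> commutative (@amul F B) -> u \in smash_ideal ->
  amul u v = 0 /\ amul v u = 0.
Proof.
case: u v => [s t] [s' t'] cA cB.
rewrite mem_smash_ideal => /and3P[/annP s0 /annP t0 _].
by rewrite /amul /= /prod_mul /= (cA s') (cB t') s0 t0.
Qed.

Definition smash : alg F := quot_alg smash_ideal.

End ProductAlgebra.
Arguments smash {F A B} wA wB.

(* Direct sum of a finite family of vector spaces. *)
Section DirectSum.
Import VectorInternalTheory.
Variables (F : fieldType) (I : finType) (T : I -> vectType F).

Definition dsum := {dffun forall i, T i}.
HB.instance Definition _ := Choice.on dsum.
Implicit Types f g h : dsum.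

Definition dsum_zero : dsum := [ffun i => 0].
Definition dsum_opp f : dsum := [ffun i => - f i].
Definition dsum_add f g : dsum := [ffun i => f i + g i].
Definition dsum_scale (a : F) f : dsum := [ffun i => a *: f i].

Fact dsum_addA : associative dsum_add.
Proof. by move=> f g h; apply/ffunP=> i; rewrite !ffunE addrA. Qed.
Fact dsum_addC : commutative dsum_add.
Proof. by move=> f g; apply/ffunP=> i; rewrite !ffunE addrC. Qed.
Fact dsum_add0 : left_id dsum_zero dsum_add.
Proof. by move=> f; apply/ffunP=> i; rewrite !ffunE add0r. Qed.
Fact dsum_addN : left_inverse dsum_zero dsum_opp dsum_add.
Proof. by move=> f; apply/ffunP=> i; rewrite !ffunE addNr. Qed.

HB.instance Definition _ :=
  GRing.isZmodule.Build dsum dsum_addA dsum_addC dsum_add0 dsum_addN.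

Fact dsum_scaleA a b f : dsum_scale a (dsum_scale b f) = dsum_scale (a * b) f.
Proof. by apply/ffunP=> i; rewrite !ffunE scalerA. Qed.
Fact dsum_scale1 : left_id 1 dsum_scale.
Proof. by move=> f; apply/ffunP=> i; rewrite !ffunE scale1r. Qed.
Fact dsum_scaleDr : right_distributive dsum_scale +%R.
Proof. by move=> a f g; apply/ffunP=> i; rewrite !ffunE scalerDr. Qed.
Fact dsum_scaleDl f : {morph dsum_scale^~ f : a b / a + b}.
Proof. by move=> a b; apply/ffunP=> i; rewrite !ffunE scalerDl. Qed.

HB.instance Definition _ := GRing.Zmodule_isLmodule.Build F dsum
  dsum_scaleA dsum_scale1 dsum_scaleDr dsum_scaleDl.

Lemma dsumD f g i : (f + g) i = f i + g i.
Proof. by rewrite ffunE. Qed.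

Lemma dsumZ a f i : (a *: f) i = a *: f i.
Proof. by rewrite ffunE. Qed.

Fact dsum_vect_iso : Vector.axiom #|{: {i : I & 'I_(dim (T i))}}| dsum.
Proof.
pose n := #|{: {i : I & 'I_(dim (T i))}}|.
pose fr (f : dsum) : 'rV[F]_n :=
  \row_k let u : {i : I & 'I_(dim (T i))} := enum_val k in
         v2r (f (tag u)) 0 (tagged u).
pose gr (r : 'rV[F]_n) : dsum :=
  [ffun i => r2v (\row_k r 0 (enum_rank (Tagged (fun i => 'I_(dim (T i))) k)))].
exists fr.
  by move=> a f g; apply/rowP=> k; rewrite !mxE /= dsumD dsumZ linearP !mxE.
exists gr => [f | r].
  apply/ffunP=> i; rewrite ffunE; apply: (canLR v2rK); apply/rowP=> k.
  by rewrite !mxE enum_rankK.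
apply/rowP=> k; rewrite mxE /= ffunE r2vK mxE.
by congr (r 0 _); rewrite -[RHS]enum_valK; case: (enum_val k).
Qed.

HB.instance Definition _ := Lmodule_hasFinDim.Build F dsum dsum_vect_iso.

End DirectSum.

Section AssociatedGraded.
Variables (F : fieldType) (A : alg F).

(* A^k / A^(k+1) for k >= 1, as the subspace of A / A^(k+1) of classes of     *)
(* elements of A^k.                                                           *)
Definition gr_comp (k : nat) : {vspace vquot (apow A k.+1)} :=
  (vcls (apow A k.+1) @: apow A k)%VS.

(* For k = i + j: the class of xy, where x and y represent the arguments.     *)
(* Keeping k separate from i + j avoids casts; see [gr_cmulE].                *)
Definition gr_cmul (i j k : nat)
    (u : subvs_of (gr_comp i)) (v : subvs_of (gr_comp j)) :
    subvs_of (gr_comp k) :=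
  vsproj (gr_comp k)
    (vcls (apow A k.+1) (amul (vrepr (vsval u)) (vrepr (vsval v)))).

Fact gr_cmulPl i j k a u v w :
  @gr_cmul i j k (a *: u + v) w = a *: gr_cmul k u w + gr_cmul k v w.
Proof. by rewrite /gr_cmul [vsval (_ + _)]linearP vreprP linearPl !linearP. Qed.

Fact gr_cmulPr i j k a u v w :
  @gr_cmul i j k w (a *: u + v) = a *: gr_cmul k w u + gr_cmul k w v.
Proof. by rewrite /gr_cmul [vsval (_ + _)]linearP vreprP linearPr !linearP. Qed.

(* Position i : 'I_(nilindex A) carries the component of degree i.+1; the     *)
(* components of degree > nilindex A are zero.                                *)
Definition gr_space : vectType F :=
  dsum (fun i : 'I_(nilindex A) => subvs_of (gr_comp i.+1) : vectType F).

Definition gr_mul (u v : gr_space) : gr_space :=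
  [ffun k : 'I_(nilindex A) =>
    \sum_(i < nilindex A) \sum_(j < nilindex A | (i.+1 + j.+1 == k.+1)%N)
      gr_cmul k.+1 (u i) (v j)].

Fact gr_mul_bilinear : bilinear_for *:%R *:%R gr_mul.
Proof.
split=> w a u v; apply/ffunP=> k; rewrite dsumD dsumZ !ffunE.
  rewrite scaler_sumr -big_split; apply: eq_bigr => i _ /=.
  rewrite scaler_sumr -big_split; apply: eq_bigr => j _ /=.
  by rewrite dsumD dsumZ gr_cmulPl.
rewrite scaler_sumr -big_split; apply: eq_bigr => i _ /=.
rewrite scaler_sumr -big_split; apply: eq_bigr => j _ /=.
by rewrite dsumD dsumZ gr_cmulPr.
Qed.

HB.instance Definition _ :=
  bilinear_isBilinear.Build F _ _ _ *:%R *:%R gr_mul gr_mul_bilinear.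

Definition gr : alg F := @Alg F gr_space gr_mul.

Definition gr_coord (u : gr) (i : 'I_(nilindex A)) : subvs_of (gr_comp i.+1) :=
  (u : gr_space) i.

Lemma apow_mul i j : associative (@amul F A) ->
  (aprodv (apow A i.+1) (apow A j.+1) <= apow A (i.+1 + j.+1))%VS.
Proof.
move=> mA; elim: i => [|i IH]; first exact: subvv.
apply/aprodvP => x y; rewrite apowS => Ax Ay.
have sub : (aprodv fullv (apow A i.+1) <=
    linfun (applyr amul y) @^-1: apow A (i.+2 + j.+1))%VS.
  apply/aprodvP => a b _ Ab; rewrite -memv_preim lfunE /= -mA.
  rewrite addSn addSn apowS memv_aprodv ?memvf //.
  by apply: (subvP IH); apply: memv_aprodv.
by have := subvP sub _ Ax; rewrite -memv_preim lfunE.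
Qed.

Lemma gr_cmulE i j x y : associative (@amul F A) ->
    (0 < i)%N -> (0 < j)%N -> x \in apow A i -> y \in apow A j ->
  gr_cmul (i + j) (vsproj (gr_comp i) (vcls _ x))
                  (vsproj (gr_comp j) (vcls _ y))
  = vsproj (gr_comp (i + j)) (vcls _ (amul x y)).
Proof.
case: i j => // i [//|j] mA _ _ Ax Ay.
rewrite /gr_cmul !vsprojK ?memv_img //; congr (vsproj _ _).
apply/eqP; rewrite -subr_eq0 -linearB /= vcls_eq0.
have := vreprK (apow A i.+2) x; have := vreprK (apow A j.+2) y.
move: (vrepr (vcls _ x)) (vrepr (vcls _ y)) => x' y' Ay' Ax'.
rewrite amulBB.
have sA := subvP (apow_mul _ _ mA).
have ijS : (i.+1 + j.+1).+1 = (i.+2 + j.+1)%N by [].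
have Sij : (i.+1 + j.+1).+1 = (i.+1 + j.+2)%N by rewrite -addnS.
have Ajy' : y' \in apow A j.+1.
  rewrite -(subrK y y'); apply: memvD => //.
  exact: (subvP (apow_sub A (leqnSn j.+1))).
have xy1 : amul (x' - x) y' \in apow A (i.+1 + j.+1).+1.
  by rewrite ijS; apply: sA; apply: memv_aprodv.
have xy2 : amul x (y' - y) \in apow A (i.+1 + j.+1).+1.
  by rewrite Sij; apply: sA; apply: memv_aprodv.
exact: memvD.
Qed.

Definition hilbert_fun (k : nat) : nat :=
  if k is 0 then 1%N else \dim (gr_comp k).

Definition hilbert : seq nat := mkseq hilbert_fun (nilindex A).+1.

Definition hilbert_symmetric : Prop :=
  forall k, (k <= nilindex A)%N ->
    hilbert_fun k = hilbert_fun (nilindex A - k).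

End AssociatedGraded.

Section Isomorphisms.
Variable F : fieldType.
Implicit Types A B : alg F.

Definition is_alg_iso A B (f : 'Hom(A, B)) : Prop :=
  bijective f /\ {morph f : x y / amul x y}.

Definition isomorphic A B : Prop := exists f : 'Hom(A, B), is_alg_iso f.

(* As in [gr], G i is the summand of degree i.+1. *)
Definition canonical_grading A (G : 'I_(nilindex A) -> {vspace A}) : Prop :=
  [/\ directv (\sum_i G i), (\sum_i G i)%VS = fullv
    & exists2 phi : 'Hom(A, gr A), is_alg_iso phi
      & forall i x, x \in G i <-> (forall j, j != i -> gr_coord (phi x) j = 0)].

Definition reduced A : Prop :=
  admissible A /\
  ~ exists (N1 N2 : alg F) (w1 : 'Hom(N1, F^o)) (w2 : 'Hom(N2, F^o)),
    [/\ admissible N1 /\ pointing w1, admissible N2 /\ pointing w2,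
        nilindex N2 = 2%N & isomorphic A (smash w1 w2)].

End Isomorphisms.

Section NilPolynomials.
Variable F : fieldType.

(* Elements of F[W] are handled as polynomial functions on W, which is        *)
(* harmless over an infinite field. A form of degree d is given by a          *)
(* homogeneous polynomial in linear coordinates.                              *)
Definition is_form (d : nat) (W : vectType F) (f : W -> F) : Prop :=
  exists2 P : {mpoly F[\dim {:W}]}, P \is d.-homog
    & forall x, f x = P.@[fun i => coord (vbasis {:W}) i x].

Definition nondegenerate_quadratic (W : vectType F) (q : W -> F) : Prop :=
  forall x, (forall y, q (x + y) - q x - q y = 0) -> x = 0.

Definition totally_isotropic (W : vectType F) (q : W -> F)
    (U : {vspace W}) : Prop := forall x, x \in U -> q x = 0.

Definition nil_polynomial (A : alg F) (W : vectType F) (p : W -> F) : Prop :=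
  exists (w : 'Hom(A, F^o)) (phi : 'Hom(W, A)),
    [/\ pointing w, lker phi = 0%VS, limg phi = lker w
      & forall x, p x = w (exp2 (phi x))].

Definition typeC (A : alg F) : Prop :=
  [/\ reduced A, (1 < \dim {:A})%N
    & exists (W : vectType F) (W1 W2 : {vspace W})
             (q : W -> F) (c : subvs_of W1 -> F) (p : W -> F),
      [/\ [/\ {:W}%VS != 0%VS, directv (W1 + W2) & (W1 + W2)%VS = fullv],
          [/\ is_form 2 q, nondegenerate_quadratic q,
              totally_isotropic q W1 & totally_isotropic q W2],
          is_form 3 c,
          forall (x : subvs_of W1) (y : subvs_of W2),
            p (vsval x + vsval y) = q (vsval x + vsval y) + c x
        & nil_polynomial A p]].

End NilPolynomials.

(* Main.v *)
From HB Require Import structures.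
Require Import Defs.
From mathcomp Require Import all_boot all_order all_algebra.
From mathcomp Require Import mpoly ring zify.

Set Implicit Arguments.
Unset Strict Implicit.
Unset Printing Implicit Defensive.

Import GRing.Theory.
Local Open Scope ring_scope.

(** Let [w] be a pointing of an admissible algebra N of nil-index 3, and
    [b x y = w (x y)], a form with radical Ann N. In ker w, the space
    W2 = N^2 /\ ker w is the orthogonal of K = { x | x N^2 = 0 } and is
    contained in K. A complement U of W2 in K is nondegenerate, and W2 is
    Lagrangian in the orthogonal V of U, so V = W1 + W2 with W1 Lagrangian too.
    Then N' = V + Ann N and N'' = U + Ann N are subalgebras annihilating each
    other, and N is their smash product. N' is reduced because its elements
    killing N'^2 have square zero, whereas a factor of nil-index 2 would
    contain such an element with nonzero square. If N itself
    is reduced then U = 0, which gives type (C), the canonical grading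
    W1 + W2 + Ann N and all dimensions. Finally a nil-polynomial of degree 3
    forces nil-index at most 3: its homogeneous parts of higher degree vanish,
    so x^nu = 0 for all x if nu > 3, and polarization contradicts N^nu <> 0. *)

(** * Linear algebra *)

Section LinearAlgebra.
Variable F : fieldType.
Implicit Types V W : vectType F.

(** The lever throughout is that [w] is injective on the line Ann N, which equals N^3 here: a
    product known to lie in N^3 vanishes as soon as [w] kills it, so orthogonality for b turns into
    annihilation in N. The quotient K / W2 is precisely what a factor of nil-index 2 can account
    for, which is why being reduced forces U = 0. Choosing W1 isotropic costs a division by 2 and is
    what puts W1 W1 inside W2, hence what makes the algebra graded. The claims on Hilbert functions
    concern an arbitrary decomposition, not the constructed one. They therefore use only facts valid
    for every smash product, namely that powers, annihilators and dimensions are governed by the two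
    factors, together with dim A + 1 = 2 dim A^2 for reduced A of nil-index 3. To apply the latter
    to a factor of type (C), its nil-index must first be recovered from the nil-polynomial, and this
    is the purpose of polarization. *)

Lemma lfun_of_linear V W (f : V -> W) :
  linear f -> {h : 'Hom(V, W) | h =1 f}.
Proof.
move=> linf.
pose g : {linear V -> W} := HB.pack f (GRing.isLinear.Build _ _ _ _ _ linf).
by exists (linfun g) => x; rewrite (lfunE g).
Qed.

Lemma lfun_bij V W (f : 'Hom(V, W)) :
  lker f = 0%VS -> limg f = fullv -> bijective f.
Proof.
move=> kf0 fW; exists (f^-1)%VF; first by apply: lker0_lfunK; apply/eqP.
by move=> y; rewrite limg_lfunVK // fW memvf.
Qed.

Lemma bij_lker0 V W (f : 'Hom(V, W)) : bijective f -> lker f = 0%VS.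
Proof. by move=> /bij_inj finj; apply/eqP/lker0P. Qed.

Lemma bij_limg V W (f : 'Hom(V, W)) : bijective f -> limg f = fullv.
Proof.
case=> g _ gK; apply/eqP; rewrite eqEsubv subvf; apply/subvP => y _.
by rewrite -(gK y) memv_img ?memvf.
Qed.

Lemma lker0_dim V W (f : 'Hom(V, W)) U :
  lker f = 0%VS -> \dim (f @: U) = \dim U.
Proof. by move=> kf0; apply: limg_dim_eq; rewrite kf0 capv0. Qed.

Lemma lker0_eq0 V W (f : 'Hom(V, W)) x : lker f = 0%VS -> f x = 0 -> x = 0.
Proof. by move=> kf0 fx0; apply/eqP; rewrite -memv0 -kf0 memv_ker fx0. Qed.

Lemma lker0_mem_img V W (f : 'Hom(V, W)) U x :
  lker f = 0%VS -> (f x \in (f @: U)%VS) = (x \in U).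
Proof.
move=> kf0; apply/idP/idP => [/memv_imgP[y Uy]|]; last exact: memv_img.
by move/(lker0P (introT eqP kf0)) ->.
Qed.

Lemma sub_limg V W (f : 'Hom(V, W)) U X :
  (f @: U <= X)%VS = (U <= f @^-1: X)%VS.
Proof.
apply/subvP/subvP => sUX x.
  by move=> Ux; rewrite -memv_preim sUX ?memv_img.
by case/memv_imgP=> u Uu ->; rewrite memv_preim sUX.
Qed.

Lemma dim_regular : \dim {:F^o} = 1%N.
Proof. by rewrite dimvf. Qed.

(** Some coordinate of the class of [x] modulo [U] is nonzero; composed with the class map and
    rescaled, it is the form sought. *)
Lemma linear_form_separates V (U : {vspace V}) x :
  x \notin U -> exists2 f : 'Hom(V, F^o), (U <= lker f)%VS & f x = 1.
Proof.
move=> Ux; pose y := vcls U x.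
have y0 : y != 0 by rewrite vcls_eq0.
have : exists i, coord (vbasis {:vquot U}) i y != 0.
  apply/existsP; apply: contraNT y0; rewrite negb_exists => /forallP y0.
  rewrite (coord_vbasis (memvf y)) big1 // => i _.
  by move/negPn/eqP: (y0 i) ->; rewrite scale0r.
case=> i ci; pose c := coord (vbasis {:vquot U}) i y.
exists (c^-1 *: (linfun (coord (vbasis {:vquot U}) i : _ -> F^o) \o vcls U)%VF).
  apply/subvP => u Uu; rewrite memv_ker scale_lfunE comp_lfunE lfunE /=.
  by move: Uu; rewrite -vcls_eq0 => /eqP ->; rewrite linear0 scaler0.
by rewrite scale_lfunE comp_lfunE lfunE /= /GRing.scale /= mulVf.
Qed.

(** Nondegeneracy on the [U] side embeds [U] in the dual of [V], which bounds the dimension; a left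
    inverse of the Gram matrix then supplies vectors of [V] dual to [vbasis U]. *)
Lemma dual_basis (T T' : vectType F) (b : T -> T' -> F)
    (V : {vspace T}) (U : {vspace T'}) :
    (forall y, {morph b^~ y : u v / u + v}) ->
    (forall y a u, b (a *: u) y = a * b u y) ->
    (forall x, {morph b x : u v / u + v}) ->
    (forall x a u, b x (a *: u) = a * b x u) ->
    (forall y, y \in U -> (forall x, x \in V -> b x y = 0) -> y = 0) ->
  (\dim U <= \dim V)%N /\
  exists2 s : 'I_(\dim U) -> T, (forall i, s i \in V)
    & forall y i, y \in U -> coord (vbasis U) i y = b (s i) y.
Proof.
move=> bDl bZl bDr bZr nd.
have b0l y : b 0 y = 0 by rewrite -[0](scale0r 0) bZl mul0r.
have b0r x : b x 0 = 0 by rewrite -[0](scale0r 0) bZr mul0r.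
have bsl y : {morph b^~ y : u v / u + v} by exact: bDl.
pose M := \matrix_(i < \dim V, j < \dim U) b (vbasis V)`_i (vbasis U)`_j.
(* A row [r] of the kernel is the coordinate vector of an element of [U] orthogonal to all of
   [V]. *)
have MT0 : kermx M^T = 0.
  apply/row_matrixP => k; rewrite row0.
  have: row k (kermx M^T) *m M^T = 0 by rewrite -row_mul mulmx_ker row0.
  move: (row k _) => r rM; pose y := \sum_j r 0 j *: (vbasis U)`_j.
  have Uy : y \in U.
    by apply: memv_suml => j _; rewrite memvZ // vbasis_mem // mem_nth ?size_tuple.
  have y0 : y = 0.
    apply: nd => // x Vx; rewrite (coord_vbasis Vx).
    rewrite (big_morph (b^~ y) (bsl y) (b0l y)) big1 // => i _.
    rewrite bZl; suff -> : b (vbasis V)`_i y = 0 by rewrite mulr0.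
    rewrite /y (big_morph _ (bDr _) (b0r _)).
    transitivity ((r *m M^T) 0 i); last by rewrite rM mxE.
    by rewrite mxE; apply: eq_bigr => j _; rewrite bZr !mxE.
  apply/rowP => j; rewrite mxE.
  have := coord_sum_free (r 0) j (basis_free (vbasisP U)).
  by rewrite -/y y0 linear0.
have freeM : row_free M^T by rewrite -kermx_eq0 MT0.
split; first by rewrite -(eqP freeM) rank_leq_col.
have /row_freeP[B' MB] := freeM.
have BM : B'^T *m M = 1%:M by rewrite -[M]trmxK -trmx_mul MB trmx1.
exists (fun i => \sum_j B'^T i j *: (vbasis V)`_j) => [i|y i Uy].
  by apply: memv_suml => j _; rewrite memvZ // vbasis_mem // mem_nth ?size_tuple.
rewrite {2}(coord_vbasis Uy) (big_morph _ (bDr _) (b0r _)).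
have bE k : b (\sum_j B'^T i j *: (vbasis V)`_j) (coord (vbasis U) k y *: (vbasis U)`_k)
    = coord (vbasis U) k y * (i == k)%:R.
  rewrite bZr (big_morph (b^~ _) (bsl _) (b0l _)).
  transitivity (coord (vbasis U) k y * (B'^T *m M) i k); last by rewrite BM mxE.
  by congr (_ * _); rewrite mxE; apply: eq_bigr => j _; rewrite bZl !mxE.
rewrite (eq_bigr _ (fun k _ => bE k)) (bigD1 i) //= eqxx mulr1 big1 ?addr0 //.
by move=> k nki; rewrite eq_sym (negPf nki) mulr0.
Qed.

End LinearAlgebra.

(** * Admissible algebras and pointings *)

Section AlgebraBasics.
Variables (F : fieldType) (A : alg F).
Implicit Types x y z : A.

Lemma amulDl x y z : amul (x + y) z = amul x z + amul y z.
Proof. exact: linearDl. Qed.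

Lemma amulDr x y z : amul x (y + z) = amul x y + amul x z.
Proof. exact: linearDr. Qed.

Lemma amulZl a x y : amul (a *: x) y = a *: amul x y.
Proof. exact: linearZl_LR. Qed.

Lemma amulZr a x y : amul x (a *: y) = a *: amul x y.
Proof. exact: linearZr_LR. Qed.

Lemma mem_apow2 x y : amul x y \in apow A 2.
Proof. by apply: memv_aprodv; apply: memvf. Qed.

Lemma apow2_sub (U : {vspace A}) :
  (forall x y, amul x y \in U) -> (apow A 2 <= U)%VS.
Proof. by move=> AU; apply/aprodvP. Qed.

Lemma nilindex_eq k :
  apow A k.+2 = 0%VS -> apow A k.+1 != 0%VS -> nilindex A = k.+1.
Proof.
move=> Ak0 Ak1; have nA : nilpotent A by exists k.+1.
have [An0 Amin] := nilindexP nA; apply/eqP; rewrite eqn_leq Amin // ltnNge.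
apply: contraNN Ak1 => le_nk; rewrite -subv0 -An0; exact: apow_sub.
Qed.

Lemma nilindex_leP k :
  nilpotent A -> reflect (apow A k.+1 = 0%VS) (nilindex A <= k)%N.
Proof.
move=> nA; have [An0 Amin] := nilindexP nA.
apply: (iffP idP) => [le_nk|]; last exact: Amin.
by apply/eqP; rewrite -subv0 -An0; apply: apow_sub.
Qed.

Section Admissible.
Hypothesis admA : admissible A.
Let mA : associative (@amul F A). Proof. by case: admA. Qed.
Let mC : commutative (@amul F A). Proof. by case: admA. Qed.
Let nA : nilpotent A. Proof. by case: admA. Qed.
Let dA : \dim (ann A) = 1%N. Proof. by case: admA. Qed.

Lemma ann_mulr x y : y \in ann A -> amul x y = 0.
Proof. by move/annP=> y0; rewrite mC. Qed.

Lemma admissible_nilindex_gt0 : (0 < nilindex A)%N.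
Proof.
rewrite ltnNge; apply/negP => /(nilindex_leP _ nA) A0.
by have := dimvS (subvf (ann A)); rewrite -[fullv]/(apow A 1) A0 dimv0 dA.
Qed.

Lemma apow_top_sub_ann : (apow A (nilindex A) <= ann A)%VS.
Proof.
have := admissible_nilindex_gt0; have [An0 _] := nilindexP nA.
case: (nilindex A) An0 => // k An0 _; apply/subvP => x Ax; apply/annP => y.
rewrite mC; apply/eqP; rewrite -memv0 -An0 apowS.
by apply: memv_aprodv; rewrite ?memvf.
Qed.

Lemma apow_top : apow A (nilindex A) = ann A.
Proof.
apply/eqP; rewrite eqEdim apow_top_sub_ann dA lt0n dimv_eq0.
have := admissible_nilindex_gt0; case E: (nilindex A) => [//|k] _.
by apply/negP => /eqP/(nilindex_leP _ nA); rewrite E ltnn.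
Qed.

(** The last nonzero term of the chain J ∩ A^k is killed by A, since multiplication by A pushes it
    into the next term. *)
Lemma ideal_meets_ann (J : {vspace A}) :
    (forall x y, y \in J -> amul x y \in J) -> J != 0%VS ->
  exists2 x, x != 0 & x \in (J :&: ann A)%VS.
Proof.
move=> idJ J0; have [An0 _] := nilindexP nA.
have exk : exists k, (J :&: apow A k.+1 == 0)%VS.
  by exists (nilindex A); rewrite An0 capv0.
case: (ex_minnP exk) => -[|k] /eqP Jk kmin.
  by move: J0; rewrite -Jk capvf eqxx.
have : (J :&: apow A k.+1)%VS != 0%VS.
  by apply/negP => Jk1; have := kmin _ Jk1; rewrite ltnn.
rewrite -vpick0; set x := vpick _ => x0.
have /memv_capP[Jx Ax] : x \in (J :&: apow A k.+1)%VS by apply: memv_pick.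
exists x => //; rewrite memv_cap Jx; apply/annP => y; rewrite mC.
apply/eqP; rewrite -memv0 -Jk memv_cap idJ // apowS.
by apply: memv_aprodv; rewrite ?memvf.
Qed.

(** As Ann A is a line, meeting it nontrivially means containing it. *)
Lemma ann_sub_ideal (J : {vspace A}) :
  (forall x y, y \in J -> amul x y \in J) -> J != 0%VS -> (ann A <= J)%VS.
Proof.
move=> idJ /(ideal_meets_ann idJ)[x x0 Jx].
rewrite (_ : ann A = J :&: ann A)%VS ?capvSl //; apply/esym/eqP.
rewrite eqEdim capvSr dA lt0n dimv_eq0; apply: contraNneq x0 => J0.
by rewrite -memv0 -J0.
Qed.

Lemma nilindex_le1P : reflect (\dim {:A} = 1%N) (nilindex A <= 1)%N.
Proof.
apply: (iffP idP) => [|dA1].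
  have := admissible_nilindex_gt0; have := apow_top.
  by case: (nilindex A) => [//|[|//]] A1 _ _; rewrite -dA -A1.
apply/nilindex_leP => //; apply/eqP; rewrite -subv0; apply: apow2_sub => x y.
have annf : ann A = fullv by apply/eqP; rewrite eqEdim subvf dA dA1.
have /annP -> : x \in ann A by rewrite annf memvf.
exact: mem0v.
Qed.

Section Pointing.
Variable w : 'Hom(A, F^o).
Hypothesis pw : pointing w.

Lemma pointing_ann_inj x : x \in ann A -> w x = 0 -> x = 0.
Proof.
have := limg_ker_dim w (ann A); rewrite pw dim_regular dA.
move=> /(canRL (addnK _))/eqP; rewrite dimv_eq0 => /eqP W0 Ax wx.
by apply/eqP; rewrite -memv0 -W0 memv_cap Ax memv_ker wx eqxx.
Qed.

Lemma pointing_onto c : exists2 x, x \in ann A & w x = c.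
Proof.
have : (c : F^o) \in (w @: ann A)%VS by rewrite pw memvf.
by case/memv_imgP=> x Ax ->; exists x.
Qed.

Lemma pointing_decomp x : exists2 a, a \in ann A & x - a \in lker w.
Proof.
have [a Aa wa] := pointing_onto (w x).
by exists a; rewrite // memv_ker linearB /= wa subrr.
Qed.

Lemma lker_cap_ann : (lker w :&: ann A = 0)%VS.
Proof.
apply/eqP; rewrite -subv0; apply/subvP => x /memv_capP[].
by rewrite memv_ker memv0 => /eqP wx Ax; rewrite (pointing_ann_inj Ax wx).
Qed.

Lemma lker_add_ann : (lker w + ann A = fullv)%VS.
Proof.
apply/eqP; rewrite eqEsubv subvf; apply/subvP => x _.
by have [a Aa wa] := pointing_decomp x; rewrite -(subrK a x) memv_add.
Qed.

(* xA is an ideal, and a nonzero ideal contains Ann A, hence is not in ker w. *)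
Lemma pointing_nondegenerate x : (forall y, w (amul x y) = 0) -> x \in ann A.
Proof.
move=> wx; pose J := limg (linfun (amul x)).
have [J0|J0] := eqVneq J 0%VS.
  apply/annP => y; apply/eqP; rewrite -memv0 -J0 /J.
  by rewrite -[amul x y]/(applyr amul y x) -[X in X \in _](lfunE (amul x)) memv_img ?memvf.
have idJ z y : y \in J -> amul z y \in J.
  case/memv_imgP=> u _ ->; rewrite lfunE /= (mC x) mA mC.
  by rewrite -[amul x _](lfunE (amul x)) memv_img ?memvf.
have [a Aa wa] := pointing_onto 1.
have /memv_imgP[u _] := subvP (ann_sub_ideal idJ J0) _ Aa.
rewrite lfunE /= => aE; move: wa; rewrite aE wx => /esym/eqP.
by rewrite oner_eq0.
Qed.

End Pointing.

Lemma exists_pointing : exists w : 'Hom(A, F^o), pointing w.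
Proof.
have a0 : vpick (ann A) \notin (0%VS : {vspace A}).
  by rewrite memv0 vpick0 -dimv_eq0 dA.
have [w _ wa] := linear_form_separates a0; exists w.
apply/eqP; rewrite eqEdim subvf dim_regular lt0n dimv_eq0.
apply/negP => /eqP w0.
have := memv_img w (memv_pick (ann A)).
by rewrite w0 wa memv0 oner_eq0.
Qed.

End Admissible.
End AlgebraBasics.

(** * Smash products realised inside an algebra *)

Section Smash.
Variable F : fieldType.

Definition alg_embedding (A B : alg F) (f : 'Hom(A, B)) : Prop :=
  lker f = 0%VS /\ {morph f : x y / amul x y}.

(* N is the smash product of its subalgebras f(A) and g(B). *)
Definition internal_smash (A B N : alg F) (f : 'Hom(A, N)) (g : 'Hom(B, N)) :=
  [/\ alg_embedding f /\ alg_embedding g,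
      forall a b, amul (f a) (g b) = 0,
      (limg f + limg g = fullv)%VS,
      (f @: ann A = limg f :&: limg g)%VS
    & (g @: ann B = limg f :&: limg g)%VS].

Lemma isomorphic_bij (A B : alg F) (f : 'Hom(A, B)) :
    lker f = 0%VS -> limg f = fullv -> {morph f : x y / amul x y} ->
  isomorphic A B.
Proof. by move=> f0 fB fM; exists f; split; first exact: lfun_bij. Qed.

Lemma isomorphic_sym (A B : alg F) : isomorphic A B -> isomorphic B A.
Proof.
case=> f [bf fM]; have f0 := bij_lker0 bf; have fB := bij_limg bf.
have fK : cancel (f^-1)%VF f by move=> y; rewrite limg_lfunVK // fB memvf.
have f'K : cancel f (f^-1)%VF by apply: lker0_lfunK; apply/eqP.
exists (f^-1)%VF; split; first by exists f.
by move=> x y; apply: (can_inj f'K); rewrite fM !fK.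
Qed.

Lemma isomorphic_dim (A B : alg F) :
  isomorphic A B -> \dim {:A} = \dim {:B}.
Proof.
by case=> f [bf _]; rewrite -(bij_limg bf) (lker0_dim _ (bij_lker0 bf)).
Qed.

Lemma internal_smash_iso (A B M N : alg F) (h : 'Hom(M, N))
    (f : 'Hom(A, M)) (g : 'Hom(B, M)) :
  is_alg_iso h -> internal_smash f g -> internal_smash (h \o f) (h \o g).
Proof.
case=> bh hM [[[f0 fM] [g0 gM]] fg0 fgN fA gB].
have h0 := bij_lker0 bh; have hN := bij_limg bh.
have lk (C : alg F) (k : 'Hom(C, M)) : lker k = 0%VS -> lker (h \o k) = 0%VS.
  move=> k0; apply/eqP; rewrite -subv0; apply/subvP => x.
  rewrite memv_ker comp_lfunE memv0 => /eqP/(lker0_eq0 h0)/(lker0_eq0 k0) ->.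
  by [].
split.
- by split; split=> [|x y]; rewrite ?comp_lfunE ?fM ?gM ?hM //; apply: lk.
- by move=> a b; rewrite !comp_lfunE -hM fg0 linear0.
- by rewrite !limg_comp -limgD fgN.
- by rewrite !limg_comp fA lker0_img_cap //; apply/eqP.
- by rewrite !limg_comp gB lker0_img_cap //; apply/eqP.
Qed.

Section SmashEmbeddings.
Variables (A B : alg F) (wA : 'Hom(A, F^o)) (wB : 'Hom(B, F^o)).
Hypotheses (admA : admissible A) (admB : admissible B).
Hypotheses (pA : pointing wA) (pB : pointing wB).

Let cA : commutative (@amul F A). Proof. by case: admA. Qed.
Let cB : commutative (@amul F B). Proof. by case: admB. Qed.

Let I := smash_ideal wA wB.

Lemma smash_cls_mul (u v : prod_alg A B) :
  @amul F (smash wA wB) (vcls I u) (vcls I v) = vcls I (amul u v).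
Proof.
by apply/esym/vcls_mul => x y Ix;
  case: (@smash_ideal_mul0 F A B wA wB _ x cA cB Ix) => [e1 e2];
  case: (@smash_ideal_mul0 F A B wA wB _ y cA cB Ix) => [e3 e4];
  rewrite ?e1 ?e2 ?e3 ?e4 mem0v.
Qed.

Lemma smash_internal :
  exists (f : 'Hom(A, smash wA wB)) (g : 'Hom(B, smash wA wB)),
    internal_smash f g.
Proof.
have [|f0 f0E] := @lfun_of_linear F A (prod_alg A B) (fun a => (a, 0)).
  by move=> c x y; congr (_, _); rewrite /= scaler0 addr0.
have [|g0 g0E] := @lfun_of_linear F B (prod_alg A B) (fun b => (0, b)).
  by move=> c x y; congr (_, _); rewrite /= scaler0 addr0.
pose f : 'Hom(A, smash wA wB) := (vcls I \o f0)%VF.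
pose g : 'Hom(B, smash wA wB) := (vcls I \o g0)%VF.
have fE a : f a = vcls I (a, 0) by rewrite /f comp_lfunE f0E.
have gE b : g b = vcls I (0, b) by rewrite /g comp_lfunE g0E.
have fgE a b : f a - g b = vcls I (a, - b).
  by rewrite fE gE -linearB /=; congr (vcls I (_, _)); rewrite /= ?subr0 ?sub0r.
(* [f a = g b] means that (a, -b) lies in [I]; the conditions on kernels and images are all read off
   from this criterion. *)
have fgP a b : f a = g b <-> [/\ a \in ann A, b \in ann B & wA a = wB b].
  split=> [/eqP|[Aa Bb wab]].
    rewrite -subr_eq0 fgE vcls_eq0 mem_smash_ideal linearN subr_eq0 memvN.
    by case/and3P=> -> -> /eqP.
  apply/eqP; rewrite -subr_eq0 fgE vcls_eq0 mem_smash_ideal linearN memvN.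
  by rewrite subr_eq0 Aa Bb wab /=.
exists f, g; split.
- split; split.
  + apply/eqP; rewrite -subv0; apply/subvP => x; rewrite memv_ker memv0.
    rewrite -(linear0 g) => /eqP/(proj1 (fgP _ _))[Ax _]; rewrite linear0.
    by move=> /(pointing_ann_inj admA pA Ax) ->.
  + move=> x y; rewrite !fE smash_cls_mul; congr (vcls I (_, _)).
    by rewrite /= amul0l.
  + apply/eqP; rewrite -subv0; apply/subvP => x; rewrite memv_ker memv0.
    rewrite -(linear0 f) => /eqP/esym/(proj1 (fgP _ _))[_ Bx]; rewrite linear0 => /esym.
    by move=> /(pointing_ann_inj admB pB Bx) ->.
  + move=> x y; rewrite !gE smash_cls_mul; congr (vcls I (_, _)).
    by rewrite /= amul0l.
- move=> a b; rewrite fE gE smash_cls_mul [X in vcls I X](_ : _ = 0) ?linear0 //.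
  by congr (_, _); rewrite /= ?amul0l ?amul0r.
- apply/eqP; rewrite eqEsubv subvf; apply/subvP => u _.
  rewrite -(vclsK u); case: (vrepr u) => a b.
  rewrite (_ : vcls _ _ = f a + g b) ?memv_add ?memv_img ?memvf //.
  by have := fgE a (- b); rewrite linearN !opprK.
- apply/eqP; rewrite eqEsubv; apply/andP; split; apply/subvP => u.
    case/memv_imgP=> a Aa ->; have [b Bb wb] := pointing_onto pB (wA a).
    rewrite memv_cap memv_img ?memvf //= (_ : f a = g b) ?memv_img ?memvf //.
    exact/fgP.
  case/memv_capP => /memv_imgP[a _ ->] /memv_imgP[b _] /(proj1 (fgP _ _))[Aa _ _].
  exact: memv_img.
- apply/eqP; rewrite eqEsubv; apply/andP; split; apply/subvP => u.
    case/memv_imgP=> b Bb ->; have [a Aa wa] := pointing_onto pA (wB b).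
    rewrite memv_cap memv_img ?memvf //= andbT (_ : g b = f a) ?memv_img ?memvf //.
    by apply/esym/fgP.
  case/memv_capP => /memv_imgP[a _ ->] /memv_imgP[b _] fab.
  have [_ Bb _] := proj1 (fgP _ _) fab; rewrite fab.
  exact: memv_img.
Qed.

Lemma isomorphic_smash_internal (N : alg F) : isomorphic N (smash wA wB) ->
  exists (f : 'Hom(A, N)) (g : 'Hom(B, N)), internal_smash f g.
Proof.
move/isomorphic_sym=> [h hiso]; have [f [g fg]] := smash_internal.
by exists (h \o f)%VF, (h \o g)%VF; apply: internal_smash_iso.
Qed.

End SmashEmbeddings.

Section InternalSmash.
Variables (A B N : alg F) (f : 'Hom(A, N)) (g : 'Hom(B, N)).
Hypothesis fg : internal_smash f g.

Let f0 : lker f = 0%VS. Proof. by case: fg => [[[]]]. Qed.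
Let g0 : lker g = 0%VS. Proof. by case: fg => [[_ []]]. Qed.
Let fM : {morph f : x y / amul x y}. Proof. by case: fg => [[[]]]. Qed.
Let gM : {morph g : x y / amul x y}. Proof. by case: fg => [[_ []]]. Qed.
Let fg0 a b : amul (f a) (g b) = 0. Proof. by case: fg. Qed.

Lemma internal_smash_decomp x : exists a b, x = f a + g b.
Proof.
have : x \in (limg f + limg g)%VS by case: fg => _ _ ->; rewrite memvf.
by case/memv_addP=> _ /memv_imgP[a _ ->] [_ /memv_imgP[b _ ->] ->]; exists a, b.
Qed.

Lemma internal_smash_ann_eq : (f @: ann A = g @: ann B)%VS.
Proof. by case: fg => _ _ _ -> ->. Qed.

Lemma internal_smash_meet a b : f a = g b -> a \in ann A /\ b \in ann B.
Proof.
move=> fab; rewrite -(lker0_mem_img _ _ f0) -(lker0_mem_img _ b g0) -fab.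
rewrite -internal_smash_ann_eq; split; case: fg => _ _ _ -> _;
by rewrite memv_cap {2}fab !memv_img ?memvf.
Qed.

Section Commutative.
Hypothesis mC : commutative (@amul F N).

Lemma internal_smash_mul a b a' b' :
  amul (f a + g b) (f a' + g b') = f (amul a a') + g (amul b b').
Proof.
by rewrite amulDl !amulDr fg0 (mC (g b)) fg0 addr0 add0r fM gM.
Qed.

(** Cross products vanish, so the powers of the two factors do not interact. *)
Lemma internal_smash_apow k :
  apow N k.+1 = (f @: apow A k.+1 + g @: apow B k.+1)%VS.
Proof.
elim: k => [|k IH]; first by case: fg.
rewrite !apowS; apply/eqP; rewrite eqEsubv; apply/andP; split.
  apply/aprodvP => x y _; rewrite IH.
  case/memv_addP=> _ /memv_imgP[a' Aa' ->] [_ /memv_imgP[b' Bb' ->] ->].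
  have [a [b ->]] := internal_smash_decomp x.
  by rewrite internal_smash_mul memv_add ?memv_img ?memv_aprodv ?memvf.
rewrite subv_add !sub_limg; apply/andP; split; apply/aprodvP => x y _ Ay;
  rewrite -memv_preim ?fM ?gM memv_aprodv ?memvf // IH.
  by rewrite (subvP (addvSl _ _)) ?memv_img.
by rewrite (subvP (addvSr _ _)) ?memv_img.
Qed.

(** An element killing N has both components killing their own factor, and the two annihilators have
    the same image. *)
Lemma internal_smash_ann : ann N = (f @: ann A)%VS.
Proof.
apply/eqP; rewrite eqEsubv; apply/andP; split; apply/subvP => x.
  have [a [b ->]] := internal_smash_decomp x => /annP ab0.
  rewrite memvD //; first last.
    rewrite internal_smash_ann_eq memv_img //; apply/annP => y.
    apply: (lker0_eq0 g0); have := ab0 (f 0 + g y).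
    by rewrite internal_smash_mul amul0r linear0 add0r.
  rewrite memv_img //; apply/annP => y; apply: (lker0_eq0 f0).
  have := ab0 (f y + g 0).
  by rewrite internal_smash_mul amul0r linear0 addr0.
case/memv_imgP=> a /annP a0 ->; apply/annP => y.
have [a' [b' ->]] := internal_smash_decomp y.
by rewrite amulDr fg0 -fM a0 linear0 addr0.
Qed.

End Commutative.

End InternalSmash.
End Smash.

(** * Smash products as sums of two subalgebras *)

Section SmashOfInternal.
Variables (F : fieldType) (A B N : alg F) (f : 'Hom(A, N)) (g : 'Hom(B, N)).
Hypotheses (admN : admissible N) (fg : internal_smash f g).
Variable w : 'Hom(N, F^o).
Hypothesis pw : pointing w.

Let mC : commutative (@amul F N). Proof. by case: admN. Qed.

Lemma alg_embedding_comm (C D : alg F) (k : 'Hom(C, D)) :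
  alg_embedding k -> commutative (@amul F D) -> commutative (@amul F C).
Proof.
case=> /eqP/lker0P k0 kM cD x y.
by apply: k0; rewrite !kM cD.
Qed.

Lemma alg_embedding_assoc (C D : alg F) (k : 'Hom(C, D)) :
  alg_embedding k -> associative (@amul F D) -> associative (@amul F C).
Proof.
case=> /eqP/lker0P k0 kM cD x y z.
by apply: k0; rewrite !kM cD.
Qed.

Lemma alg_embedding_apow (C D : alg F) (k : 'Hom(C, D)) n :
  alg_embedding k -> (k @: apow C n <= apow D n)%VS.
Proof.
case=> _ kM; case: n => [|n]; first exact: subvf.
elim: n => [|n IH]; first exact: subvf.
rewrite !apowS sub_limg; apply/aprodvP => x y _ Cy.
rewrite -memv_preim kM memv_aprodv ?memvf //.
by apply: (subvP IH); rewrite memv_img.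
Qed.

Lemma alg_embedding_apow0 (C D : alg F) (k : 'Hom(C, D)) n :
  alg_embedding k -> apow D n = 0%VS -> apow C n = 0%VS.
Proof.
move=> kE D0; have := alg_embedding_apow n kE; rewrite D0 subv0 => /eqP kC.
by apply/eqP; rewrite -dimv_eq0 -(lker0_dim _ (proj1 kE)) kC dimv0.
Qed.

Lemma internal_smash_admissible : admissible A /\ admissible B.
Proof.
have [[Ef Eg] _ _ _ _] := fg; have [mA _ [n Nn] dN] := admN.
have dA : \dim (ann A) = 1%N.
  by rewrite -dN (internal_smash_ann fg mC) (lker0_dim _ (proj1 Ef)).
split; split.
- exact: alg_embedding_assoc Ef mA.
- exact: alg_embedding_comm Ef mC.
- by exists n; apply: alg_embedding_apow0 Ef Nn.
- by [].
- exact: alg_embedding_assoc Eg mA.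
- exact: alg_embedding_comm Eg mC.
- by exists n; apply: alg_embedding_apow0 Eg Nn.
- rewrite -dN (internal_smash_ann fg mC) (internal_smash_ann_eq fg).
  by rewrite (lker0_dim _ (proj1 Eg)).
Qed.

Lemma internal_smash_pointing : pointing (w \o f) /\ pointing (w \o g).
Proof.
rewrite /pointing !limg_comp -(internal_smash_ann_eq fg).
by rewrite -(internal_smash_ann fg mC).
Qed.

(** The map (a, b) -> f a + g b is onto, and its kernel is the smash ideal for the two restrictions
    of [w]. *)
Lemma smash_of_internal : isomorphic N (smash (w \o f) (w \o g)).
Proof.
apply: isomorphic_sym.
have [admA admB] := internal_smash_admissible.
have [pA pB] := internal_smash_pointing.
set I := smash_ideal (w \o f) (w \o g).
have [|Phi PhiE] := @lfun_of_linear F (prod_alg A B) N (fun u => f u.1 + g u.2).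
  by move=> c u v; rewrite !linearP /= scalerDr addrACA.
(* If f s + g t = 0 then f s lies in both images, so s and t are in the annihilators; conversely, f
   s + g t lies in Ann N, where [w] detects its vanishing. *)
have kerP : lker Phi = I.
  apply/vspaceP => -[s t]; rewrite memv_ker PhiE mem_smash_ideal !comp_lfunE /=.
  apply/idP/idP => [/eqP st0|/and3P[As Bt wst]].
    have /(internal_smash_meet fg)[-> Bt] : f s = g (- t).
      by apply/eqP; rewrite linearN -addr_eq0 st0.
    by rewrite memvN in Bt; rewrite Bt -linearD /= st0 linear0 eqxx.
  apply/eqP/(pointing_ann_inj admN pw); last by rewrite linearD; apply/eqP.
  rewrite (internal_smash_ann fg mC) memvD ?memv_img //.
  by rewrite (internal_smash_ann_eq fg) memv_img.
have [|k kE] := @lfun_of_linear F (smash (w \o f) (w \o g)) N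
                  (fun u => Phi (vrepr u)).
  by move=> c u v; rewrite vreprP linearP.
have kcls x : k (vcls I x) = Phi x.
  apply/eqP; rewrite kE -subr_eq0 -linearB -memv_ker kerP.
  exact: vreprK.
apply: (@isomorphic_bij _ _ _ k).
- apply/eqP; rewrite -subv0; apply/subvP => u; rewrite memv_ker memv0.
  rewrite -[u]vclsK kcls -memv_ker kerP => Iu.
  by rewrite vcls_eq0.
- apply/eqP; rewrite eqEsubv subvf; apply/subvP => x _.
  have [a [b ->]] := internal_smash_decomp fg x.
  by rewrite -[X in X \in _](PhiE (a, b)) -kcls memv_img ?memvf.
- move=> u v; rewrite -[u]vclsK -[v]vclsK (smash_cls_mul _ _ admA admB).
  rewrite !kcls; case: (vrepr u) (vrepr v) => [a b] [a' b'].
  by rewrite !PhiE (internal_smash_mul fg mC).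
Qed.

End SmashOfInternal.

Section Subalgebra.
Variables (F : fieldType) (A : alg F) (S : {vspace A}).

(** Projecting back onto [S] gives a bilinear product for any subspace; it is the product of [A]
    once [S] is closed under multiplication. *)
Definition sub_mul (u v : subvs_of S) : subvs_of S :=
  vsproj S (amul (vsval u) (vsval v)).

Fact sub_mul_bilinear : bilinear_for *:%R *:%R sub_mul.
Proof.
by split=> v a x y; rewrite /sub_mul [vsval (_ + _)]linearP ?linearPl ?linearPr linearP.
Qed.

HB.instance Definition _ :=
  bilinear_isBilinear.Build F _ _ _ *:%R *:%R sub_mul sub_mul_bilinear.

Definition sub_alg : alg F := @Alg F (subvs_of S) sub_mul.

Lemma sub_alg_embedding :
    (forall x y, x \in S -> y \in S -> amul x y \in S) ->
  exists (B : alg F) (f : 'Hom(B, A)), alg_embedding f /\ limg f = S.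
Proof.
move=> clS; have [|f fE] := @lfun_of_linear F sub_alg A (fun u => vsval u).
  by [].
exists sub_alg, f; split; first split.
- by apply/eqP/lker0P => x y; rewrite !fE; apply: subvs_inj.
- by move=> x y; rewrite !fE /amul /= /sub_mul vsprojK ?clS ?subvsP.
- apply/eqP; rewrite eqEsubv; apply/andP; split; apply/subvP => x.
    by case/memv_imgP=> u _ ->; rewrite fE subvsP.
  by move=> Sx; rewrite -(vsprojK Sx) -fE memv_img ?memvf.
Qed.

End Subalgebra.

(** An element of [S] that kills [S] also kills [T], hence all of N, and symmetrically for [T]; this
    identifies the annihilator of each factor with the intersection. *)
Lemma internal_smash_of_subspaces (F : fieldType) (N : alg F)
    (S T : {vspace N}) :
    commutative (@amul F N) ->
    (forall x y, x \in S -> y \in S -> amul x y \in S) ->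
    (forall x y, x \in T -> y \in T -> amul x y \in T) ->
    (forall x y, x \in S -> y \in T -> amul x y = 0) ->
    (S + T = fullv)%VS -> (S :&: T = ann N)%VS ->
  exists (A B : alg F) (f : 'Hom(A, N)) (g : 'Hom(B, N)),
    [/\ internal_smash f g, limg f = S & limg g = T].
Proof.
move=> mC clS clT ST0 STf STa.
have [A [f [Ef fS]]] := sub_alg_embedding clS.
have [B [g [Eg gT]]] := sub_alg_embedding clT.
exists A, B, f, g; split => //; split => //.
- by move=> a b; apply: ST0; rewrite -?fS -?gT; apply: memv_img; apply: memvf.
- by rewrite fS gT.
- rewrite fS gT; apply/eqP; rewrite eqEsubv; apply/andP; split.
    apply/subvP => _ /memv_imgP[a Aa ->].
    rewrite STa; apply/annP => y.
    have : y \in (S + T)%VS by rewrite STf memvf.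
    case/memv_addP=> s Ss [t Tt ->]; rewrite amulDr [X in _ + X]ST0 //; last first.
      by rewrite -fS memv_img ?memvf.
    move: Ss; rewrite -fS => /memv_imgP[a' _ ->].
    by rewrite -(proj2 Ef) (annP _ Aa) linear0 addr0.
  apply/subvP => x; rewrite STa => Nx; have : x \in S.
    by have : x \in (S :&: T)%VS; [rewrite STa | case/memv_capP].
  rewrite -fS => /memv_imgP[a _ xE]; rewrite xE memv_img //; apply/annP => a'.
  by apply: (lker0_eq0 (proj1 Ef)); rewrite (proj2 Ef) -xE; apply/annP.
- rewrite fS gT; apply/eqP; rewrite eqEsubv; apply/andP; split.
    apply/subvP => _ /memv_imgP[b Bb ->].
    rewrite STa; apply/annP => y.
    have : y \in (S + T)%VS by rewrite STf memvf.
    case/memv_addP=> s Ss [t Tt ->]; rewrite amulDr (mC _ s) ST0 //; last first.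
      by rewrite -gT memv_img ?memvf.
    move: Tt; rewrite -gT => /memv_imgP[b' _ ->].
    by rewrite -(proj2 Eg) (annP _ Bb) linear0 addr0.
  apply/subvP => x; rewrite STa => Nx; have : x \in T.
    by have : x \in (S :&: T)%VS; [rewrite STa | case/memv_capP].
  rewrite -gT => /memv_imgP[b _ xE]; rewrite xE memv_img //; apply/annP => b'.
  by apply: (lker0_eq0 (proj1 Eg)); rewrite (proj2 Eg) -xE; apply/annP.
Qed.

(** * The splitting of an algebra of nil-index three *)

(** The orthogonal decomposition of [lker w], recorded mostly as facts on products rather than on
    the form w(xy). The isotropy of [W1] is contained in [splitting_11], because [W2] lies in
    [lker w]. *)
Record nil3_splitting (F : fieldType) (N : alg F) (w : 'Hom(N, F^o))
    (U W1 W2 : {vspace N}) : Prop := Nil3Splitting {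
  splitting_cap12 : (W1 :&: W2 = 0)%VS;
  splitting_capU : ((W1 + W2) :&: U = 0)%VS;
  splitting_lker : (W1 + W2 + U = lker w)%VS;
  splitting_square : (apow N 2 = W2 + ann N)%VS;
  splitting_WU : forall x u, x \in (W1 + W2)%VS -> u \in U -> amul x u = 0;
  splitting_UU : forall u v, u \in U -> v \in U -> amul u v \in ann N;
  splitting_U_nondeg :
    forall u, u \in U -> (forall v, v \in U -> amul u v = 0) -> u = 0;
  splitting_11 : forall x y, x \in W1 -> y \in W1 -> amul x y \in W2;
  splitting_12 : forall x y, x \in W1 -> y \in W2 -> amul x y \in ann N;
  splitting_22 : forall x y, x \in W2 -> y \in W2 -> amul x y = 0;
  splitting_dim : \dim W1 = \dim W2;
  splitting_kill : forall x, x \in (W1 + W2)%VS ->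
    (forall y, y \in apow N 2 -> amul x y = 0) -> x \in W2
}.

Section Orthogonal.
Variables (F : fieldType) (N : alg F) (w : 'Hom(N, F^o)).

(** Computed in all of N, so it always contains Ann N; the splitting intersects it with [lker w]. *)
Definition orth (V : {vspace N}) : {vspace N} :=
  (\bigcap_(y <- vbasis V) lker (w \o linfun (applyr amul y)))%VS.

Lemma orthP (V : {vspace N}) x :
  reflect (forall y, y \in V -> w (amul x y) = 0) (x \in orth V).
Proof.
have memE (s : seq N) :
    (x \in \bigcap_(y <- s) lker (w \o linfun (applyr amul y)))%VS
    = all (fun y => w (amul x y) == 0) s.
  elim: s => [|y s IH]; first by rewrite big_nil memvf.
  by rewrite big_cons memv_cap IH memv_ker comp_lfunE lfunE.
rewrite /orth memE; apply: (iffP allP) => [x0 y Vy | x0 y Vy]; last first.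
  by rewrite x0 ?vbasis_mem.
rewrite (coord_vbasis Vy) linear_sumr linear_sum big1 // => i _.
rewrite amulZr linearZ /=.
by rewrite (eqP (x0 _ _)) ?scaler0 // mem_nth // size_tuple.
Qed.

Lemma dual_basis_pointing (V U : {vspace N}) :
    (forall y, y \in U -> (forall x, x \in V -> w (amul x y) = 0) -> y = 0) ->
  (\dim U <= \dim V)%N /\
  exists2 s : 'I_(\dim U) -> N, (forall i, s i \in V)
    & forall y i, y \in U -> coord (vbasis U) i y = w (amul (s i) y).
Proof.
move=> nd; apply: (@dual_basis F N N (fun x y => w (amul x y))) => //.
- by move=> y u v /=; rewrite amulDl linearD.
- by move=> y a u /=; rewrite amulZl linearZ.
- by move=> y u v /=; rewrite amulDr linearD.
- by move=> y a u /=; rewrite amulZr linearZ.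
Qed.

(** The representing vector carries the values of [phi] on [vbasis U] as coefficients on the dual
    family in [V]. *)
Lemma riesz (V U : {vspace N}) (phi : 'Hom(N, F^o)) :
    (forall y, y \in U -> (forall x, x \in V -> w (amul x y) = 0) -> y = 0) ->
  exists2 x, x \in V & forall y, y \in U -> w (amul x y) = phi y.
Proof.
case/dual_basis_pointing=> _ [s sV sE].
exists (\sum_(i < \dim U) (phi (vbasis U)`_i : F) *: s i).
  by apply: memv_suml => i _; rewrite memvZ.
move=> y Uy; rewrite {2}(coord_vbasis Uy) linear_sumlz !linear_sum.
apply: eq_bigr => i _; rewrite amulZl !linearZ /= -sE //.
exact: mulrC.
Qed.

End Orthogonal.

Section Splitting.
Variables (F : fieldType) (N : alg F) (w : 'Hom(N, F^o)).
Hypotheses (char_neq2 : (2 : F) != 0) (admN : admissible N).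
Hypotheses (nilN : nilindex N = 3%N) (pw : pointing w).

Let mA : associative (@amul F N). Proof. by case: admN. Qed.
Let mC : commutative (@amul F N). Proof. by case: admN. Qed.

Lemma nil3_apow3 : apow N 3 = ann N.
Proof. by rewrite -(apow_top admN) nilN. Qed.

Lemma nil3_ann_sub : (ann N <= apow N 2)%VS.
Proof. by rewrite -nil3_apow3; apply: apow_sub. Qed.

Lemma nil3_mul_square x y : y \in apow N 2 -> amul x y \in ann N.
Proof. by move=> Ny; rewrite -nil3_apow3; apply: memv_aprodv; rewrite ?memvf. Qed.

Lemma nil3_square_mul x y : x \in apow N 2 -> y \in apow N 2 -> amul x y = 0.
Proof.
move=> Nx Ny; have := subvP (apow_mul 1 1 mA) _ (memv_aprodv Nx Ny).
have [] := nilindexP (let: And4 _ _ nN _ := admN in nN).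
by rewrite nilN => -> _; rewrite memv0 => /eqP.
Qed.

Lemma nil3_splittingP : exists U W1 W2, nil3_splitting w U W1 W2.
Proof.
have annN2 := subvP nil3_ann_sub.
have wC x y : w (amul x y) = w (amul y x) by rewrite mC.
have kerW x y :
    (forall y, y \in lker w -> w (amul x y) = 0) -> w (amul x y) = 0.
  move=> wx; have [a Aa ya] := pointing_decomp pw y.
  by rewrite -(subrK a y) amulDr linearD /= wx // add0r ann_mulr // linear0.
(* The radical of w(xy) is Ann N, which meets [lker w] only in 0. *)
have ndW x : x \in lker w ->
    (forall y, y \in lker w -> w (amul x y) = 0) -> x = 0.
  move=> Wx wx; apply: (pointing_ann_inj admN pw).
    2: by apply/eqP; rewrite -memv_ker.
  by apply: (pointing_nondegenerate admN pw) => y; apply: kerW.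
pose W := lker w; pose W2 := (W :&: apow N 2)%VS.
pose K := (W :&: orth w (apow N 2))%VS.
(* The product lies in N^3 = Ann N, where [w] is injective, so orthogonality to N^2 is already
   annihilation. *)
have KN2 x y : x \in K -> y \in apow N 2 -> amul x y = 0.
  case/memv_capP=> _ /orthP Kx Ny; apply: (pointing_ann_inj admN pw); last exact: Kx.
  exact: nil3_mul_square.
have W2K : (W2 <= K)%VS.
  apply/subvP => x /memv_capP[Wx Nx]; rewrite memv_cap Wx; apply/orthP => y Ny.
  by rewrite nil3_square_mul // linear0.
have squareE : apow N 2 = (W2 + ann N)%VS.
  apply/eqP; rewrite eqEsubv subv_add capvSr nil3_ann_sub !andbT.
  apply/subvP => y Ny; have [a Aa ya] := pointing_decomp pw y.
  by rewrite -(subrK a y) memv_add // memv_cap ya memvB // annN2.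
(* Biduality: an x outside N^2 is detected by a form vanishing on N^2, and the vector representing
   that form lies in [K] without being orthogonal to x. *)
have KK x : x \in W -> (forall k, k \in K -> w (amul x k) = 0) -> x \in W2.
  move=> Wx xK; rewrite memv_cap Wx /=; apply/negPn/negP.
  case/linear_form_separates=> phi /subvP phiN2 phix.
  have [|k Wk kE] := @riesz F N w W W phi.
    by move=> y Wy wy; apply: ndW => // z Wz; rewrite wC; apply: wy.
  suff Kk : k \in K.
    by have := kE x Wx; rewrite wC xK // phix => /esym/eqP; rewrite oner_eq0.
  rewrite memv_cap Wk; apply/orthP => y; rewrite squareE.
  case/memv_addP=> z /memv_capP[Wz Nz] [a Aa ->]; rewrite amulDr linearD /=.
  rewrite (ann_mulr admN _ Aa) linear0 addr0 kE //; apply/eqP.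
  by rewrite -memv_ker phiN2.
pose U := (K :\: W2)%VS.
have UK : (U <= K)%VS := diffvSl _ _.
have KE : (W2 + U = K)%VS.
  by rewrite /U -{2}(addv_diff_cap K W2) addvC (capv_idPr W2K).
have UW2 x : x \in U -> x \in W2 -> x = 0.
  by move=> Ux W2x; apply/eqP; rewrite -memv0 -(capv_diff K W2) memv_cap -/U Ux.
have W2_K x y : x \in W2 -> y \in K -> amul x y = 0.
  by move=> /memv_capP[_ Nx] Ky; rewrite mC KN2.
(* A vector of [U] orthogonal to [U] is orthogonal to [W2 + U], that is to [K], hence lies in
   [W2]. *)
have ndU u : u \in U -> (forall v, v \in U -> w (amul u v) = 0) -> u = 0.
  move=> Uu wu; apply: UW2 => //; apply: KK.
    by have /memv_capP[] := subvP UK _ Uu.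
  move=> k; rewrite -KE => /memv_addP[a W2a [v Uv ->]].
  by rewrite amulDr linearD /= (wu v) // addr0 wC W2_K ?linear0 // (subvP UK).
pose V := (W :&: orth w U)%VS.
have UV0 : (V :&: U = 0)%VS.
  apply/eqP; rewrite -subv0; apply/subvP => u /memv_capP[/memv_capP[_ /orthP Vu] Uu].
  by rewrite memv0; apply/eqP/ndU.
have UW : (U <= W)%VS by apply: subv_trans UK (capvSl _ _).
(* Orthogonal projection: subtract from x the element of [U] that represents y -> w(xy) on [U]. *)
have VUE : (V + U = W)%VS.
  apply/eqP; rewrite eqEsubv subv_add capvSl UW /=.
  apply/subvP => x Wx; pose phi := (w \o linfun (amul x))%VF.
  have [|u Uu uE] := @riesz F N w U U phi.
    by move=> y Uy wy; apply: ndU => // z Uz; rewrite wC wy.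
  rewrite -(subrK u x) memv_add // memv_cap memvB //; last by apply: (subvP UW).
  apply/orthP => y Uy; have := uE y Uy; rewrite /phi comp_lfunE lfunE /= => uy.
  by rewrite linearBl linearB /= uy subrr.
have W2V : (W2 <= V)%VS.
  apply/subvP => x W2x; have /memv_capP[Wx _] := W2x; rewrite memv_cap Wx.
  by apply/orthP => u /(subvP UK) Ku; rewrite W2_K // linear0.
have VK x : x \in V -> x \in K -> x \in W2.
  move=> Vx; rewrite -KE => /memv_addP[a W2a [u Uu xE]].
  suff -> : x = a by [].
  rewrite xE [u](_ : _ = 0) ?addr0 //; apply/eqP; rewrite -memv0 -UV0 memv_cap Uu andbT.
  by rewrite -(addKr a u) -xE memvD // memvN (subvP W2V).
(* With [W2W2] below, this says that [W2] is its own orthogonal in [V]. *)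
have VW2 x : x \in V -> (forall v, v \in W2 -> w (amul x v) = 0) -> x \in W2.
  move=> Vx wx; apply: VK => //; have /memv_capP[Wx _] := Vx.
  rewrite memv_cap Wx; apply/orthP => y; rewrite squareE => /memv_addP[a W2a [b Ab ->]].
  by rewrite amulDr linearD /= (wx a) // (ann_mulr admN _ Ab) linear0 addr0.
have ndV x : x \in V -> (forall v, v \in V -> w (amul x v) = 0) -> x = 0.
  move=> Vx wx; have /memv_capP[Wx /orthP xU] := Vx; apply: ndW => // y.
  rewrite -/W -VUE => /memv_addP[v Vv [u Uu ->]].
  by rewrite amulDr linearD /= (wx v) // (xU u) // addr0.
pose L := (V :\: W2)%VS.
have LV : (L <= V)%VS := diffvSl _ _.
have VE : (W2 + L = V)%VS.
  by rewrite /L -{2}(addv_diff_cap V W2) addvC (capv_idPr W2V).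
have LW2 x : x \in L -> x \in W2 -> x = 0.
  by move=> Lx W2x; apply/eqP; rewrite -memv0 -(capv_diff V W2) memv_cap -/L Lx.
have W2W2 x y : x \in W2 -> y \in W2 -> amul x y = 0.
  by move=> W2x W2y; apply: W2_K => //; apply: (subvP W2K).
(* [L] and [W2] are paired without radical on either side, so their dimensions agree. *)
have [|dimLW2 [s sW2 sE]] := @dual_basis_pointing F N w W2 L.
  move=> y Ly wy; apply: LW2 => //; apply: VW2; first exact: (subvP LV).
  by move=> v W2v; rewrite wC wy.
have dimW2L : (\dim W2 <= \dim L)%N.
  apply: (proj1 (dual_basis_pointing (w := w) _)) => y W2y wy.
  apply: ndV; first exact: (subvP W2V).
  move=> v; rewrite -VE => /memv_addP[a W2a [l Ll ->]].
  by rewrite amulDr linearD /= W2W2 // linear0 add0r wC wy.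
(* [L] need not be isotropic. The correction [h], with values in [W2], is built so that w(h(x) y) =
   - w(xy) / 2 for y in [L]; in (l + h l)(l' + h l') the two cross terms then cancel w(l l'), and (h
   l)(h l') = 0. *)
have [|h hE] := @lfun_of_linear F N N
    (fun x => - 2^-1 *: \sum_(i < \dim L) (w (amul x (vbasis L)`_i) : F) *: s i).
  move=> c x y; rewrite scalerA mulrC -scalerA -scalerDr; congr (_ *: _).
  rewrite scaler_sumr -big_split; apply: eq_bigr => i _ /=.
  by rewrite scalerA -scalerDl linearPl linearP.
have hW2 x : h x \in W2.
  by rewrite hE memvZ // memv_suml // => i _; rewrite memvZ.
have hL x y : y \in L -> w (amul (h x) y) = - 2^-1 * w (amul x y).
  move=> Ly; rewrite hE amulZl linearZ /=; congr (_ * _).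
  rewrite {2}(coord_vbasis Ly) linear_sumlz linear_sumr !linear_sum.
  apply: eq_bigr => i _; rewrite amulZl amulZr !linearZ /= -sE //.
  exact: mulrC.
pose W1 := ((\1 + h) @: L)%VS.
have W1P x : x \in W1 -> exists2 l, l \in L & x = l + h l.
  by case/memv_imgP=> l Ll ->; exists l; rewrite // add_lfunE id_lfunE.
have W1V : (W1 <= V)%VS.
  apply/subvP => x /W1P[l Ll ->].
  by apply: memvD; [apply: (subvP LV) | apply: (subvP W2V)].
have W12V : (W1 + W2 = V)%VS.
  apply/eqP; rewrite eqEsubv subv_add W1V W2V /= -VE subv_add addvSr /=.
  apply/subvP => l Ll; rewrite -(addrK (h l) l) memv_add ?memvN //.
  by apply/memv_imgP; exists l; rewrite // add_lfunE id_lfunE.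
have W1_ker x y : x \in W1 -> y \in W1 -> w (amul x y) = 0.
  move=> /W1P[l Ll ->] /W1P[l' Ll' ->].
  rewrite amulDl !amulDr !linearD /= (hL l l') // (wC l (h l')) (hL l' l) //.
  rewrite (W2W2 (h l) (h l')) // linear0 addr0 (wC l' l) -addrA -mulrDl -opprD.
  by rewrite -[2^-1]mul1r -mulrDl divff // mulN1r subrr.
have UN2 u y : u \in U -> y \in apow N 2 -> amul u y = 0.
  by move=> /(subvP UK); apply: KN2.
exists U, W1, W2; split.
- apply/eqP; rewrite -subv0; apply/subvP => x /memv_capP[/W1P[l Ll ->] W2l].
  rewrite memv0 [l]LW2 ?linear0 ?addr0 //.
  by rewrite -(addrK (h l) l) memvB.
- by rewrite W12V.
- by rewrite W12V.
- by [].
(* As [u] kills N^2, (xu)y = u(xy) = 0, so xu lies in Ann N; orthogonality then makes it 0. *)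
- move=> x u; rewrite W12V => Vx Uu; apply: (pointing_ann_inj admN pw).
    apply: (pointing_nondegenerate admN pw) => y.
    by rewrite mC mA (mC y) mC UN2 ?linear0 // mem_apow2.
  by have /memv_capP[_ /orthP->] := Vx.
- move=> u v Uu Uv; apply: (pointing_nondegenerate admN pw) => y.
  by rewrite -mA UN2 ?linear0 // mem_apow2.
- by move=> u Uu u0; apply: ndU => // v Uv; rewrite u0 // linear0.
- move=> x y W1x W1y; rewrite memv_cap mem_apow2 andbT memv_ker.
  by rewrite W1_ker.
- by move=> x y _ /memv_capP[_ N2y]; apply: nil3_mul_square.
- exact: W2W2.
- rewrite (_ : \dim W1 = \dim L); first by apply/eqP; rewrite eqn_leq dimLW2.
  apply: limg_dim_eq; apply/eqP; rewrite -subv0; apply/subvP => l /memv_capP[Ll].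
  rewrite memv_ker add_lfunE id_lfunE memv0 addr_eq0 => /eqP lE.
  by rewrite [l]LW2 // lE memvN.
- move=> x; rewrite W12V => Vx xN2; apply: VK => //.
  have /memv_capP[Wx _] := Vx; rewrite memv_cap Wx; apply/orthP => y Ny.
  by rewrite xN2 // linear0.
Qed.

End Splitting.

(** * Reduced algebras *)

Section NilindexThree.
Variable F : fieldType.
Hypothesis char_neq2 : (2 : F) != 0.
Implicit Types A B N : alg F.

Lemma apow2_eq0 A : commutative (@amul F A) ->
  (forall x : A, amul x x = 0) -> apow A 2 = 0%VS.
Proof.
move=> mC sq0; apply/eqP; rewrite -subv0; apply: apow2_sub => x y; rewrite memv0.
have := sq0 (x + y).
rewrite amulDl !amulDr !sq0 add0r addr0 (mC y) -mulr2n -scaler_nat.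
by move/eqP; rewrite scaler_eq0 (negPf char_neq2).
Qed.

(* In a smash product with an algebra B of nil-index 2 the elements of B      *)
(* violate the hypothesis.                                                    *)
Lemma reduced_criterion A : admissible A ->
    (forall x : A, (forall y, y \in apow A 2 -> amul x y = 0) ->
       amul x x = 0) ->
  reduced A.
Proof.
move=> admA sqA; split=> //; case=> A' [B [wA [wB [[admA' pA] [admB pB] nilB iso]]]].
have [mA mC _ _] := admA; have [mB cB nB _] := admB.
have [f [g fg]] := isomorphic_smash_internal admA' admB pA pB iso.
have [[Ef Eg] fg0 _ _ _] := fg.
have [B3 _] := nilindexP nB; rewrite nilB in B3.
suff : (nilindex B <= 1)%N by rewrite nilB.
apply/nilindex_leP => //; apply: apow2_eq0 => // b.
(* g(b) kills N^2: it annihilates the image of [A'], and B B^2 = 0 because [B] has nil-index 2. *)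
apply: (lker0_eq0 (proj1 Eg)); rewrite (proj2 Eg); apply: sqA => y.
rewrite (internal_smash_apow fg mC 1).
case/memv_addP=> _ /memv_imgP[a' _ ->] [_ /memv_imgP[b' Bb' ->] ->].
rewrite amulDr (mC (g b)) fg0 add0r -(proj2 Eg).
suff -> : amul b b' = 0 by rewrite linear0.
by apply/eqP; rewrite -memv0 -B3 apowS memv_aprodv ?memvf.
Qed.

Section SplittingConsequences.
Variables (N : alg F) (w : 'Hom(N, F^o)) (U W1 W2 : {vspace N}).
Hypotheses (admN : admissible N) (nilN : nilindex N = 3%N) (pw : pointing w).
Hypothesis spl : nil3_splitting w U W1 W2.

Let mA : associative (@amul F N). Proof. by case: admN. Qed.
Let mC : commutative (@amul F N). Proof. by case: admN. Qed.

Lemma splitting_W2_square : (W2 <= apow N 2)%VS.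
Proof. by rewrite (splitting_square spl) addvSl. Qed.

Lemma splitting_W2_mul x y : x \in W2 -> y \in apow N 2 -> amul x y = 0.
Proof.
by move=> /(subvP splitting_W2_square) Nx; apply: (nil3_square_mul admN nilN).
Qed.

Lemma splitting_internal_smash :
  exists (A B : alg F) (f : 'Hom(A, N)) (g : 'Hom(B, N)),
    [/\ internal_smash f g, limg f = (W1 + W2 + ann N)%VS
      & limg g = (U + ann N)%VS].
Proof.
have annM x y : y \in ann N -> amul x y = 0 by apply: ann_mulr.
apply: internal_smash_of_subspaces => //.
- move=> x y _ _; apply: subvP (mem_apow2 x y).
  by rewrite (splitting_square spl) addvS ?addvSr.
- move=> _ _ /memv_addP[u Uu [a Aa ->]] /memv_addP[v Uv [b Ab ->]].
  rewrite amulDl !amulDr (annM _ b) // (annM _ b) // (mC a v) (annM v a) // !addr0.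
  by apply: subvP (splitting_UU spl Uu Uv); apply: addvSr.
- move=> _ _ /memv_addP[u Uu [a Aa ->]] /memv_addP[v Uv [b Ab ->]].
  rewrite amulDl !amulDr (annM _ b) // (annM _ b) // (mC a v) (annM v a) // !addr0.
  exact: splitting_WU spl _ _ _ _.
- apply/eqP; rewrite eqEsubv subvf /= -(lker_add_ann pw) -(splitting_lker spl).
  rewrite subv_add [X in X && _]subv_add -andbA; apply/and3P; split.
  + by apply: subv_trans (addvSl _ _); apply: addvSl.
  + by apply: subv_trans (addvSr _ _); apply: addvSl.
  + by apply: subv_trans (addvSr _ _); apply: addvSr.
- apply/eqP; rewrite eqEsubv subv_cap !addvSr !andbT; apply/subvP => x.
  case/memv_capP=> /memv_addP[v Vv [a Aa ->]] /memv_addP[u Uu [b Ab E]].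
  (* The vector v - u = b - a lies in both [lker w] and Ann N, hence is 0; so v = u lies in
     [W1 + W2] and in [U], and vanishes. *)
  have vuE : v - u = b - a by rewrite -(addrK a v) E addrAC (addrC u) addrK.
  have : v - u \in (lker w :&: ann N)%VS.
    rewrite memv_cap -{1}(splitting_lker spl) memv_add ?memvN //= vuE.
    exact: memvB.
  rewrite lker_cap_ann // memv0 subr_eq0 => /eqP vu.
  rewrite memvD // (_ : v = 0) ?mem0v //; apply/eqP.
  by rewrite -memv0 -(splitting_capU spl) memv_cap Vv vu.
Qed.

Section Factors.
Variables (A B : alg F) (f : 'Hom(A, N)) (g : 'Hom(B, N)).
Hypotheses (fg : internal_smash f g) (fS : limg f = (W1 + W2 + ann N)%VS).
Hypothesis gT : limg g = (U + ann N)%VS.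

Let admA : admissible A. Proof. by case: (internal_smash_admissible admN fg). Qed.
Let admB : admissible B. Proof. by case: (internal_smash_admissible admN fg). Qed.
Let f0 : lker f = 0%VS. Proof. by case: fg => [[[]]]. Qed.
Let g0 : lker g = 0%VS. Proof. by case: fg => [[_ []]]. Qed.
Let fM : {morph f : x y / amul x y}. Proof. by case: fg => [[[]]]. Qed.
Let gM : {morph g : x y / amul x y}. Proof. by case: fg => [[_ []]]. Qed.
Let fg0 a b : amul (f a) (g b) = 0. Proof. by case: fg. Qed.

Lemma splitting_right_mul b b' : g (amul b b') \in ann N.
Proof.
have gU c : g c \in (U + ann N)%VS by rewrite -gT memv_img ?memvf.
rewrite gM; have /memv_addP[u Uu [a Aa ->]] := gU b.
have /memv_addP[v Uv [a' Aa' ->]] := gU b'.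
rewrite amulDl !amulDr (ann_mulr admN _ Aa') (ann_mulr admN _ Aa').
by rewrite (mC a v) (ann_mulr admN _ Aa) !addr0 (splitting_UU spl).
Qed.

Lemma splitting_right_apow3 : apow B 3 = 0%VS.
Proof.
apply/eqP; rewrite -subv0 apowS; apply/aprodvP => x y _ By.
have : (apow B 2 <= g @^-1: ann N)%VS.
  by apply: apow2_sub => b b'; rewrite -memv_preim splitting_right_mul.
move/subvP/(_ _ By); rewrite -memv_preim memv0 => gy.
by apply/eqP/(lker0_eq0 g0); rewrite gM ann_mulr.
Qed.

Lemma splitting_right_nilindex : (nilindex B <= 2)%N.
Proof. by apply/nilindex_leP; [case: admB | apply: splitting_right_apow3]. Qed.

(** [B] contributes nothing to N^3, so the nonzero N^3 = Ann N comes from A^3. *)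
Lemma splitting_left_nilindex : nilindex A = 3%N.
Proof.
have [N4 _] := nilindexP (let: And4 _ _ nN _ := admN in nN).
rewrite nilN in N4; apply: nilindex_eq.
  exact: alg_embedding_apow0 (conj f0 fM) N4.
apply: contraTneq isT => A3; have [_ _ _ dN] := admN.
move: dN; rewrite -(nil3_apow3 admN nilN) (internal_smash_apow fg mC 2).
by rewrite A3 splitting_right_apow3 !limg0 addv0 dimv0.
Qed.

(** Killing A^2 amounts to killing N^2, which confines the [W1 + W2] part of f x to [W2], where all
    products vanish. *)
Lemma splitting_left_reduced : reduced A.
Proof.
apply: reduced_criterion => // x xA2; apply: (lker0_eq0 f0); rewrite fM.
have : f x \in (W1 + W2 + ann N)%VS by rewrite -fS memv_img ?memvf.
case/memv_addP=> v Vv [a Aa fxE].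
have W2v : v \in W2.
  apply: (splitting_kill spl Vv) => y.
  rewrite (internal_smash_apow fg mC 1).
  case/memv_addP=> _ /memv_imgP[a' Aa' ->] [_ /memv_imgP[b' _ ->] ->].
  have -> : v = f x - a by rewrite fxE addrK.
  rewrite linearBl (annP _ Aa) subr0 amulDr fg0 -fM xA2 //.
  by rewrite linear0 addr0.
rewrite fxE amulDl !amulDr (ann_mulr admN _ Aa) (ann_mulr admN _ Aa).
by rewrite (annP _ Aa) !addr0 (splitting_22 spl).
Qed.

(** A nonzero [U] has nonzero products by nondegeneracy, so [B] would have nil-index exactly 2. *)
Lemma splitting_reduced_U0 : reduced N -> U = 0%VS.
Proof.
case=> _ nsm; apply/eqP/negPn/negP; rewrite -vpick0 => u0; case: nsm.
have [pA pB] := internal_smash_pointing admN fg pw.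
exists A, B, (w \o f)%VF, (w \o g)%VF; split=> //; last exact: smash_of_internal.
apply: nilindex_eq splitting_right_apow3 _; apply: contra_neq u0 => B2.
have Uu := memv_pick U; apply: (splitting_U_nondeg spl Uu) => v Uv.
have gU c : c \in U -> exists b, c = g b.
  move=> Uc; have : c \in limg g by rewrite gT (subvP (addvSl _ _)).
  by case/memv_imgP=> b _; exists b.
have [b ->] := gU _ Uu; have [b' ->] := gU _ Uv; rewrite -gM.
have := mem_apow2 b b'; rewrite B2 memv0 => /eqP ->.
by rewrite linear0.
Qed.

End Factors.
End SplittingConsequences.

Lemma nil3_decomposition N : admissible N -> nilindex N = 3%N ->
  exists (A B : alg F) (wA : 'Hom(A, F^o)) (wB : 'Hom(B, F^o)),
    [/\ [/\ reduced A, nilindex A = 3%N & pointing wA],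
        admissible B /\ pointing wB, (nilindex B <= 2)%N
      & isomorphic N (smash wA wB)].
Proof.
move=> admN nilN; have [w pw] := exists_pointing admN.
have [U [W1 [W2 spl]]] := nil3_splittingP char_neq2 admN nilN pw.
have [A [B [f [g [fg fS gT]]]]] := splitting_internal_smash admN pw spl.
have [admA admB] := internal_smash_admissible admN fg.
have [pA pB] := internal_smash_pointing admN fg pw.
exists A, B, (w \o f)%VF, (w \o g)%VF; split=> //.
- split=> //; first exact: (splitting_left_reduced admN spl fg fS).
  exact: (splitting_left_nilindex admN nilN spl fg gT).
- exact: (splitting_right_nilindex admN spl fg gT).
- exact: smash_of_internal.
Qed.

Lemma reduced_nil3_splitting N (w : 'Hom(N, F^o)) :
    reduced N -> nilindex N = 3%N -> pointing w ->
  exists W1 W2, nil3_splitting w 0 W1 W2.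
Proof.
move=> redN nilN pw; have admN := proj1 redN.
have [U [W1 [W2 spl]]] := nil3_splittingP char_neq2 admN nilN pw.
have [A [B [f [g [fg fS gT]]]]] := splitting_internal_smash admN pw spl.
have U0 := splitting_reduced_U0 admN pw spl fg gT redN.
by exists W1, W2; rewrite -U0.
Qed.

(** If [B] is a line, it equals its annihilator, whose image already lies in that of [A]; hence [f]
    is onto. *)
Lemma nilindex_le1_isomorphic A B N (f : 'Hom(A, N)) (g : 'Hom(B, N)) :
    admissible B -> internal_smash f g -> \dim {:B} = 1%N -> isomorphic N A.
Proof.
move=> [_ _ _ dB] fg dB1; have [[Ef Eg] _ fgN fA gB] := fg.
apply/isomorphic_sym/(@isomorphic_bij _ _ _ f); [exact: (proj1 Ef)| |exact: (proj2 Ef)].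
have annB : ann B = fullv by apply/eqP; rewrite eqEdim subvf dB dB1.
by rewrite -fgN; apply/esym/addv_idPl; rewrite -annB gB capvSl.
Qed.

(** The 1 accounts for the line in which the two images meet. *)
Lemma internal_smash_dim A B N (f : 'Hom(A, N)) (g : 'Hom(B, N)) :
    admissible A -> internal_smash f g ->
  (\dim {:N} + 1 = \dim {:A} + \dim {:B})%N.
Proof.
move=> [_ _ _ dA] [[Ef Eg] _ fgN fA gB].
rewrite -fgN -dA -(lker0_dim (ann A) (proj1 Ef)) fA dimv_sum_cap.
by rewrite !lker0_dim ?(proj1 Ef) ?(proj1 Eg).
Qed.

(* An algebra of nil-index 2 is the smash product of its annihilator with     *)
(* itself, hence not reduced.                                                 *)
Lemma reduced_nilindex_neq2 N : reduced N -> nilindex N <> 2%N.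
Proof.
case=> admN nsm nilN; apply: nsm; have [w pw] := exists_pointing admN.
have [mA mC _ dN] := admN.
have annM x y : y \in ann N -> amul x y = 0 by apply: ann_mulr.
have [|||||A [B [f [g [fg fS gT]]]]] :=
    @internal_smash_of_subspaces _ N (ann N) fullv mC.
- by move=> x y _ Ny; rewrite annM // mem0v.
- by move=> x y _ _; rewrite memvf.
- by move=> x y /annP.
- by rewrite addvf.
- by rewrite capvf.
have [admA admB] := internal_smash_admissible admN fg.
have [pA pB] := internal_smash_pointing admN fg pw.
exists A, B, (w \o f)%VF, (w \o g)%VF; split=> //; last exact: smash_of_internal.
have [[Ef Eg] _ _ _ _] := fg.
have apB k : (g @: apow B k)%VS = apow N k.
  have gk : (limg g)%VS = fullv by [].
  case: k => [|k]; first exact: gk.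
  elim: k => [|k IH]; first exact: gk.
  apply/eqP; rewrite eqEsubv alg_embedding_apow //=; rewrite apowS.
  apply/aprodvP => x y _; rewrite -IH => /memv_imgP[b Bb ->].
  have : x \in limg g by rewrite gT memvf.
  case/memv_imgP=> a _ ->; rewrite -(proj2 Eg) memv_img // apowS.
  by rewrite memv_aprodv ?memvf.
have dimB k : \dim (apow B k) = \dim (apow N k).
  by rewrite -(lker0_dim _ (proj1 Eg)) apB.
have nN : nilpotent N by case: admN.
apply: nilindex_eq.
  apply/eqP; rewrite -dimv_eq0 dimB dimv_eq0; apply/eqP/nilindex_leP => //.
  by rewrite nilN.
rewrite -dimv_eq0 dimB dimv_eq0; apply/eqP => /(nilindex_leP _ nN).
by rewrite nilN.
Qed.

End NilindexThree.

(** * Forms and type (C) *)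

Section Forms.
Variables (F : fieldType) (W : vectType F).
Implicit Types x y z : W.

Lemma scalar_coord (f : W -> F) x : scalar f ->
  f x = \sum_i coord (vbasis {:W}) i x * f (vbasis {:W})`_i.
Proof.
move=> linf; have [|h hE] := @lfun_of_linear F W F^o f; first exact: linf.
rewrite -[LHS]hE {1}(coord_vbasis (memvf x)) linear_sum.
by apply: eq_bigr => i _; rewrite linearZ /= hE.
Qed.

Lemma dhomogXU n i : ('X_i : {mpoly F[n]}) \is 1.-homog.
Proof. by rewrite dhomogX /= mdeg1. Qed.

Lemma bilinear_is_form (b : W -> W -> F) :
    (forall y, scalar (b^~ y)) -> (forall x, scalar (b x)) ->
  is_form 2 (fun x => b x x).
Proof.
move=> bl br; pose e i := (vbasis {:W})`_i.
exists (\sum_(i < \dim {:W}) \sum_(j < \dim {:W}) b (e i) (e j) *: ('X_i * 'X_j)).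
  apply: rpred_sum => i _; apply: rpred_sum => j _; apply: dhomogZ.
  exact: (dhomogM (dhomogXU i) (dhomogXU j)).
move=> x; rewrite (scalar_coord x (bl x)) raddf_sum; apply: eq_bigr => i _ /=.
rewrite (scalar_coord x (br _)) raddf_sum mulr_sumr; apply: eq_bigr => j _ /=.
by rewrite mevalZ mevalM !mevalXU mulrA mulrC.
Qed.

Lemma trilinear_is_form (t : W -> W -> W -> F) :
    (forall y z, scalar (fun x => t x y z)) ->
    (forall x z, scalar (fun y => t x y z)) -> (forall x y, scalar (t x y)) ->
  is_form 3 (fun x => t x x x).
Proof.
move=> t1 t2 t3; pose e i := (vbasis {:W})`_i.
exists (\sum_(i < \dim {:W}) \sum_(j < \dim {:W}) \sum_(k < \dim {:W})
          t (e i) (e j) (e k) *: ('X_i * ('X_j * 'X_k))).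
  apply: rpred_sum => i _; apply: rpred_sum => j _; apply: rpred_sum => k _.
  apply: dhomogZ.
  exact: (dhomogM (dhomogXU i) (dhomogM (dhomogXU j) (dhomogXU k))).
move=> x; rewrite (scalar_coord x (t1 x x)) raddf_sum; apply: eq_bigr => i _ /=.
rewrite (scalar_coord x (t2 _ x)) raddf_sum mulr_sumr; apply: eq_bigr => j _ /=.
rewrite (scalar_coord x (t3 _ _)) raddf_sum !mulr_sumr; apply: eq_bigr => k _ /=.
by rewrite mevalZ !mevalM !mevalXU !mulrA mulrC !mulrA.
Qed.

Lemma meval_dhomog n d (P : {mpoly F[n]}) (v v' : 'I_n -> F) t :
    P \is d.-homog -> (forall i, v' i = t * v i) ->
  P.@[v'] = t ^+ d * P.@[v].
Proof.
move=> /dhomogP homP v'E; rewrite !mevalE mulr_sumr big_seq [RHS]big_seq.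
apply: eq_bigr => m Pm; rewrite mulrCA; congr (_ * _).
rewrite -(homP m Pm) /= mdegE -prodrXr -big_split /=.
by apply: eq_bigr => i _; rewrite v'E exprMn.
Qed.

Lemma is_form_homogeneous d (f : W -> F) t x :
  is_form d f -> f (t *: x) = t ^+ d * f x.
Proof.
case=> P homP fE; rewrite !fE; apply: meval_dhomog homP _ => i.
by rewrite linearZ.
Qed.

End Forms.

Section ReducedTypeC.
Variables (F : fieldType) (A : alg F).
Hypothesis charF : [pchar F] =i pred0.

Lemma char0_natr_neq0 n : (n.+1%:R : F) != 0.
Proof. by rewrite (proj1 (pcharf0P F) charF). Qed.

Lemma exp2_nil3 (x : A) : nilindex A = 3%N ->
  exp2 x = 2^-1 *: amul x x + 6^-1 *: amul x (amul x x).
Proof.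
by move=> nilA; rewrite /exp2 nilA big_ltn // big_ltn // big_geq // addr0.
Qed.

Lemma polar_identity (a b d : F) :
  2^-1 * (a + d + (d + b)) - 2^-1 * a - 2^-1 * b = d.
Proof. by field; exact: char0_natr_neq0 1. Qed.

Lemma reduced_nil3_typeC : reduced A -> nilindex A = 3%N -> typeC A.
Proof.
move=> redA nilA; have admA := proj1 redA.
have [mA mC nA dA] := admA; have [w pw] := exists_pointing admA.
have char2 := char0_natr_neq0 1.
have [W1 [W2 spl]] := reduced_nil3_splitting char2 redA nilA pw.
have kerE : (W1 + W2 = lker w)%VS by rewrite -(splitting_lker spl) addv0.
have dimA : (1 < \dim {:A})%N.
  rewrite ltn_neqAle -{2}dA dimvS ?subvf // andbT eq_sym.
  by apply/negP => /eqP/(nilindex_le1P admA); rewrite nilA.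
split=> //; pose W : vectType F := subvs_of (lker w).
have [|phi phiE] := @lfun_of_linear F W A vsval; first by [].
have phi0 : lker phi = 0%VS.
  by apply/eqP/lker0P => x y; rewrite !phiE; apply: subvs_inj.
have phiD : limg phi = lker w.
  apply/eqP; rewrite eqEsubv; apply/andP; split; apply/subvP => x.
    by case/memv_imgP=> u _ ->; rewrite phiE subvsP.
  by move=> Sx; rewrite -(vsprojK Sx) -[vsval _]phiE memv_img ?memvf.
pose V1 := (phi @^-1: W1)%VS; pose V2 := (phi @^-1: W2)%VS.
have imV1 : (phi @: V1 = W1)%VS.
  by apply: lpreimK; rewrite phiD -kerE addvSl.
have imV2 : (phi @: V2 = W2)%VS.
  by apply: lpreimK; rewrite phiD -kerE addvSr.
(* [q] and [c] are the terms k = 2 and k = 3 of [w (exp2 x)], whence the factors 1/2! and 1/3!. *)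
pose q (x : W) := 2^-1 * w (amul (phi x) (phi x)).
pose c (x : subvs_of V1) :=
  6^-1 * w (amul (phi (vsval x)) (amul (phi (vsval x)) (phi (vsval x)))).
pose p (x : W) := w (exp2 (phi x)).
have wq x y : q (x + y) - q x - q y = w (amul (phi x) (phi y)).
  rewrite /q linearD amulDl !amulDr !linearD /= (mC (phi y)).
  exact: polar_identity.
exists W, V1, V2, q, c, p; split.
- split.
  + rewrite -dimv_eq0 -(lker0_dim _ phi0) phiD dimv_eq0.
    apply/negP => /eqP w0; have := lker_add_ann pw; rewrite w0 add0v => annf.
    by move: dimA; rewrite -annf dA.
  + rewrite directvE /= -(lker0_dim (V1 + V2) phi0) limgD imV1 imV2.
    rewrite -(lker0_dim V1 phi0) -(lker0_dim V2 phi0) imV1 imV2.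
    rewrite dimv_disjoint_sum ?eqxx //; exact: splitting_cap12 spl.
  + apply/eqP; rewrite -(eq_limg_ker0 _ _ (introT eqP phi0)) limgD.
    by rewrite imV1 imV2 phiD kerE.
- split.
  + have := @bilinear_is_form F W (fun x y => 2^-1 * w (amul (phi x) (phi y))).
    apply.
      by move=> y a x z /=; rewrite [phi (_ + _)]linearP amulDl amulZl linearP /= mulrDr mulrCA.
    by move=> y a x z /=; rewrite [phi (_ + _)]linearP amulDr amulZr linearP /= mulrDr mulrCA.
  (* By [wq] the polar form of [q] is w(xy), whose radical Ann A meets [lker w] in 0. *)
  + move=> x xq; apply: (lker0_eq0 phi0).
    have wx : phi x \in lker w by rewrite -phiD memv_img ?memvf.
    apply: (pointing_ann_inj admA pw); last by apply/eqP; rewrite -memv_ker.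
    apply: (pointing_nondegenerate admA pw) => y.
    have [a Aa ya] := pointing_decomp pw y.
    rewrite -(subrK a y) amulDr linearD /= (ann_mulr admA _ Aa) linear0 addr0.
    by move: ya; rewrite -phiD => /memv_imgP[u _ ->]; rewrite -wq.
  + move=> x; rewrite -memv_preim => W1x.
    have := splitting_11 spl W1x W1x => /(subvP (addvSr W1 _)).
    by rewrite kerE memv_ker /q => /eqP ->; rewrite mulr0.
  + move=> x; rewrite -memv_preim => W2x.
    by rewrite /q (splitting_22 spl) // linear0 mulr0.
- have := @trilinear_is_form F (subvs_of V1) (fun x y z =>
    6^-1 * w (amul (phi (vsval x)) (amul (phi (vsval y)) (phi (vsval z))))).
  apply; move=> y z a u v /=; rewrite [phi (_ + _)]linearP;
  by rewrite ?(amulDl, amulDr, amulZl, amulZr) linearP /= mulrDr mulrCA.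
- move=> x y; rewrite /p /q /c (exp2_nil3 _ nilA) linearD !linearZ /=.
  congr (_ + _); congr (_ * _); congr (w _); rewrite linearD.
  have W1x : phi (vsval x) \in W1 by rewrite memv_preim subvsP.
  have W2y : phi (vsval y) \in W2 by rewrite memv_preim subvsP.
  rewrite /=; set X := phi _; set Y := phi (vsval y).
  (* [Y] lies in [W2], so it kills A^2, and only X^3 survives in the expansion of (X + Y)^3. *)
  have YN u v : amul Y (amul u v) = 0.
    by rewrite (splitting_W2_mul admA nilA spl) // mem_apow2.
  rewrite amulDl YN addr0 amulDl amulDr (mC X (amul Y _)) -mA YN addr0.
  by rewrite !amulDr (mC X Y) (mC X (amul Y _)) -mA YN addr0.
- by exists w, phi; split.
Qed.

End ReducedTypeC.

(** * Canonical gradings and Hilbert functions *)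

Section Grading.
Variables (F : fieldType) (A : alg F).
Variable G : 'I_(nilindex A) -> {vspace A}.
Hypotheses (mA : associative (@amul F A)).
Hypotheses (dxG : directv (\sum_i G i)) (Gf : (\sum_i G i)%VS = fullv).
Hypothesis powG : forall k, (apow A k.+1 = \sum_(i < nilindex A | (k <= i)%N) G i)%VS.
(** Stated by components because the degree i.+1 + j.+1 may exceed [nilindex A]; then no index
    carries it and the product is forced to be 0. *)
Hypothesis mulG : forall i j x y, x \in G i -> y \in G j ->
  exists2 z : 'I_(nilindex A) -> A, (forall k, z k \in G k) /\
      (forall k : 'I_(nilindex A), (i.+1 + j.+1 != k.+1)%N -> z k = 0)
    & amul x y = \sum_k z k.

Let pi := sumv_pi_for (esym Gf).

Lemma grading_piG i x : pi i x \in G i. Proof. exact: memv_sum_pi. Qed.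

Lemma grading_pi_sum x : \sum_i pi i x = x.
Proof. by apply: sumv_pi_sum; rewrite memvf. Qed.

Lemma grading_pi_uniq (z : 'I_(nilindex A) -> A) i :
  (forall k, z k \in G k) -> pi i (\sum_k z k) = z i.
Proof.
move=> Gz; have /directv_sum_unique dx := dxG.
have := dx (fun k => pi k (\sum_k z k)) z (fun k _ => grading_piG k _) (fun k _ => Gz k).
by rewrite grading_pi_sum eqxx => /esym/forall_inP/(_ i isT)/eqP.
Qed.

Lemma grading_pi_id i x : x \in G i -> pi i x = x.
Proof.
move=> Gx; have := @grading_pi_uniq (fun k => if k == i then x else 0) i.
rewrite (bigD1 i) //= eqxx big1 ?addr0 => [-> // k|k /negPf-> //].
by case: eqP => [->|_]; rewrite ?mem0v.
Qed.

Lemma grading_pow_pi k x : x \in apow A k.+1 ->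
  forall i : 'I_(nilindex A), (i < k)%N -> pi i x = 0.
Proof.
rewrite powG => /memv_sumP[z Gz ->] i lt_ik.
pose z' (j : 'I_(nilindex A)) := if (k <= j)%N then z j else 0.
rewrite big_mkcond (@grading_pi_uniq z') /z'; first by rewrite leqNgt lt_ik.
by move=> j; case: ifP => [/Gz|_]; rewrite ?mem0v.
Qed.

Lemma grading_G_pow i : (G i <= apow A i.+1)%VS.
Proof. by rewrite powG (sumv_sup i). Qed.

Lemma grading_pi_pow k x : (forall i : 'I_(nilindex A), (i < k)%N -> pi i x = 0) ->
  x \in apow A k.+1.
Proof.
move=> x0; rewrite -(grading_pi_sum x); apply: memv_suml => i _.
have [lt_ik|le_ki] := ltnP i k; first by rewrite x0 ?mem0v.
apply: (subvP (apow_sub A (_ : k.+1 <= i.+1)%N)) => //.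
by apply: (subvP (grading_G_pow i)); apply: grading_piG.
Qed.

Let cl (i : 'I_(nilindex A)) (x : A) : subvs_of (gr_comp A i.+1) :=
  vsproj (gr_comp A i.+1) (vcls (apow A i.+2) x).

(** Elements of A^(i+2) have no component of index i, so [G i] embeds in A^(i+1) / A^(i+2). *)
Lemma grading_cl_eq0 i x : x \in G i -> cl i x = 0 -> x = 0.
Proof.
move=> Gx cx; have := vsprojK (memv_img (vcls (apow A i.+2)) (subvP (grading_G_pow i) _ Gx)).
rewrite -/(gr_comp A i.+1) -/(cl i x) cx linear0 => /esym/eqP.
rewrite vcls_eq0 => Nx; rewrite -(grading_pi_id Gx).
exact: grading_pow_pi Nx _ _.
Qed.

Lemma canonical_gradingP : canonical_grading G.
Proof.
split=> //.
have [|phi phiE] := @lfun_of_linear F A (gr A)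
    (fun x => [ffun i => cl i (pi i x)] : gr_space A).
  move=> a x y; apply/ffunP=> i; rewrite dsumD dsumZ !ffunE.
  by rewrite /cl !linearP.
have phiC x i : gr_coord (phi x) i = cl i (pi i x).
  by rewrite /gr_coord phiE ffunE.
have phi0 i x : gr_coord (phi x) i = 0 -> pi i x = 0.
  by rewrite phiC; apply: grading_cl_eq0; apply: grading_piG.
exists phi; last first.
  move=> i x; split=> [Gx j nji|x0].
    rewrite phiC (_ : pi j x = 0) ?/cl ?linear0 //.
    have := @grading_pi_uniq (fun k => if k == i then x else 0) j.
    rewrite (bigD1 i) //= eqxx big1 ?addr0 => [->|k /negPf-> //].
      by rewrite (negPf nji).
    by move=> k; case: eqP => [->|_]; rewrite ?mem0v.
  rewrite -(grading_pi_sum x) (bigD1 i) //= big1 ?addr0 ?grading_piG //.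
  by move=> j nji; apply: phi0; apply: x0.
split.
  apply: lfun_bij.
    apply/eqP; rewrite -subv0; apply/subvP => x; rewrite memv_ker memv0 => /eqP x0.
    rewrite -(grading_pi_sum x) big1 // => i _; apply: phi0.
    by rewrite x0 /gr_coord ffunE.
  apply/eqP; rewrite eqEsubv subvf; apply/subvP => u _.
  (* Surjectivity: lift each coordinate of [u] to [r i] in A^(i+1) and keep only its component of
     index i; what is dropped lies in A^(i+2). *)
  pose r i := vrepr (vsval (gr_coord u i)).
  have rN i : r i \in apow A i.+1.
    have /memv_imgP[x Nx xE] := subvsP (gr_coord u i).
    rewrite /r xE -[vrepr _](subrK x) memvD //.
    by apply: (subvP (apow_sub A (leqnSn i.+1))); apply: vreprK.
  pose y := \sum_i pi i (r i).
  rewrite (_ : u = phi y) ?memv_img ?memvf //; apply/ffunP => i.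
  rewrite -[LHS]/(gr_coord u i) -[RHS]/(gr_coord (phi y) i) phiC.
  rewrite /y grading_pi_uniq => [|k]; last exact: grading_piG.
  rewrite -[LHS]vsvalK; congr (vsproj _ _); apply/eqP.
  rewrite -[vsval (gr_coord u i)]vclsK -subr_eq0 -linearB vcls_eq0 -/(r i).
  apply: grading_pi_pow => k; rewrite ltnS linearB /= => le_ki.
  have [->|nki] := eqVneq k i; first by rewrite (grading_pi_id (grading_piG i (r i))) subrr.
  have lt_ki : (k < i)%N by rewrite ltn_neqAle le_ki andbT (inj_eq val_inj).
  rewrite (grading_pow_pi (rN i) lt_ki) sub0r; apply/eqP; rewrite oppr_eq0.
  apply/eqP/(grading_pow_pi _ lt_ki); apply: (subvP (grading_G_pow i)).
  exact: grading_piG.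
move=> x y; apply/ffunP => k.
rewrite -[LHS]/(gr_coord (phi (amul x y)) k) phiC.
rewrite -[amul (phi x) _]/(gr_mul (phi x) (phi y)) ffunE.
have -> : pi k (amul x y) = \sum_(i < nilindex A)
    \sum_(j < nilindex A | (i.+1 + j.+1 == k.+1)%N) amul (pi i x) (pi j y).
  rewrite -{1}(grading_pi_sum x) -{1}(grading_pi_sum y) linear_sumlz linear_sum.
  apply: eq_bigr => i _; rewrite linear_sumr linear_sum [RHS]big_mkcond /=.
  apply: eq_bigr => j _.
  have [z [Gz z0] ->] := mulG (grading_piG i x) (grading_piG j y).
  rewrite grading_pi_uniq //; case: ifP => [/eqP ij|/negbT]; last exact: z0.
  rewrite (bigD1 k) //= big1 ?addr0 // => l nlk; apply: z0.
  by rewrite ij eqSS eq_sym.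
rewrite /cl !linear_sum; apply: eq_bigr => i _.
rewrite !linear_sum; apply: eq_bigr => j /eqP ij.
have Np l u : pi l u \in apow A l.+1.
  by apply: (subvP (grading_G_pow l)); apply: grading_piG.
rewrite -[(phi x : gr_space A) i]/(gr_coord (phi x) i).
rewrite -[(phi y : gr_space A) j]/(gr_coord (phi y) j) !phiC.
have := @gr_cmulE F A i.+1 j.+1 _ _ mA isT isT (Np i x) (Np j y).
by rewrite ij => /esym.
Qed.

End Grading.

Section Hilbert.
Variables (F : fieldType).
Implicit Types A : alg F.

Lemma dim_gr_comp A k : \dim (gr_comp A k) = (\dim (apow A k) - \dim (apow A k.+1))%N.
Proof.
have := limg_ker_dim (vcls (apow A k.+1)) (apow A k).
rewrite (_ : apow A k :&: _ = apow A k.+1)%VS => [<-|]; first by rewrite addKn.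
rewrite (_ : lker _ = apow A k.+1); first by apply/capv_idPr/apow_sub.
by apply/vspaceP => x; rewrite memv_ker vcls_eq0.
Qed.

Lemma hilbert_nil1 A : nilpotent A -> nilindex A = 1%N ->
  hilbert A = [:: 1; \dim {:A}]%N.
Proof.
move=> nA nilA; have [A2 _] := nilindexP nA; rewrite nilA in A2.
by rewrite /hilbert nilA /mkseq /= dim_gr_comp A2 dimv0 subn0.
Qed.

Lemma hilbert_nil2 A : admissible A -> nilindex A = 2%N ->
  hilbert A = [:: 1; \dim {:A} - 1; 1]%N.
Proof.
move=> admA nilA; have [_ _ nA dA] := admA.
have [A3 _] := nilindexP nA; have A2 := apow_top admA; rewrite nilA in A2 A3.
by rewrite /hilbert nilA /mkseq /= !dim_gr_comp A3 A2 dimv0 dA.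
Qed.

Lemma hilbert_nil3 A : admissible A -> nilindex A = 3%N ->
  hilbert A = [:: 1; \dim {:A} - \dim (apow A 2); \dim (apow A 2) - 1; 1]%N.
Proof.
move=> admA nilA; have [_ _ nA dA] := admA.
have [A4 _] := nilindexP nA; have A3 := apow_top admA; rewrite nilA in A3 A4.
by rewrite /hilbert nilA /mkseq /= !dim_gr_comp A4 A3 dimv0 dA.
Qed.

End Hilbert.

Section ReducedGrading.
Variables (F : fieldType) (A : alg F).
Hypotheses (char_neq2 : (2 : F) != 0).
Hypotheses (redA : reduced A) (nilA : nilindex A = 3%N).

Let admA : admissible A := proj1 redA.

(** With n the common dimension of [W1] and [W2], dim A = 2n + 1 and dim A^2 = n + 1; this is the
    source of the symmetry of the Hilbert function. *)
Lemma reduced_nil3_dim : (\dim {:A} + 1 = 2 * \dim (apow A 2))%N.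
Proof.
have [w pw] := exists_pointing admA; have [_ _ _ dA] := admA.
have [W1 [W2 spl]] := reduced_nil3_splitting char_neq2 redA nilA pw.
have W2w : (W2 <= lker w)%VS.
  by rewrite -(splitting_lker spl) addv0 addvSr.
have W2A : (W2 :&: ann A = 0)%VS.
  by apply/eqP; rewrite -subv0 -(lker_cap_ann admA pw) capvS.
rewrite (splitting_square spl) dimv_disjoint_sum // dA.
rewrite -(lker_add_ann pw) dimv_disjoint_sum ?lker_cap_ann // dA.
rewrite -(splitting_lker spl) addv0 dimv_disjoint_sum ?(splitting_cap12 spl) //.
rewrite (splitting_dim spl) mulnDr muln1 mul2n addnn.
by rewrite -addnA.
Qed.

Lemma reduced_nil3_canonical_grading :
  exists G : 'I_(nilindex A) -> {vspace A}, canonical_grading G.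
Proof.
have [w pw] := exists_pointing admA; have [mA mC nA dA] := admA.
have [W1 [W2 spl]] := reduced_nil3_splitting char_neq2 redA nilA pw.
have kerE : (W1 + W2 = lker w)%VS by rewrite -(splitting_lker spl) addv0.
(* Index k carries degree k.+1: [W1], [W2] and Ann A sit in degrees 1, 2 and 3. *)
pose G' k := if k is k'.+1 then if k' is _.+1 then ann A else W2 else W1.
pose G (i : 'I_(nilindex A)) := G' i.
have annM x y : y \in ann A -> amul x y = 0 by apply: ann_mulr.
have sumG (P : pred nat) : (\sum_(i < nilindex A | P i) G i =
   (if P 0%N then W1 else 0) + (if P 1%N then W2 else 0) + (if P 2%N then ann A else 0))%VS.
  by rewrite big_mkcond /G nilA !big_ord_recl big_ord0 /= addv0 addvA.
have Gf : (\sum_i G i)%VS = fullv.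
  by rewrite (sumG xpredT) kerE lker_add_ann.
exists G; apply: canonical_gradingP => //.
- rewrite directvE /= Gf /G nilA !big_ord_recl big_ord0 /= addn0.
  rewrite -(lker_add_ann pw) dimv_disjoint_sum ?lker_cap_ann // -kerE.
  by rewrite dimv_disjoint_sum ?(splitting_cap12 spl) // addnA.
- move=> k; rewrite (sumG (fun i => k <= i)%N).
  case: k => [|[|[|k]]] /=; rewrite ?add0v ?addv0.
  + by rewrite kerE lker_add_ann.
  + exact: splitting_square spl.
  + exact: nil3_apow3.
  + have [A4 _] := nilindexP nA; rewrite nilA in A4.
    by apply/eqP; rewrite -subv0 -A4 apow_sub.
have lift (i : nat) (z : A) (lt_i : (i < nilindex A)%N) : z \in G' i ->
    exists2 u : 'I_(nilindex A) -> A, (forall k, u k \in G k) /\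
      (forall k : 'I_(nilindex A), (i.+1 != k.+1)%N -> u k = 0)
    & z = \sum_k u k.
  move=> Gz; exists (fun k => if k == i :> nat then z else 0).
    split=> [k|k]; first by rewrite /G; case: eqP => [->|_]; rewrite ?mem0v.
    by rewrite eqSS eq_sym => /negPf->.
  rewrite (bigD1 (Ordinal lt_i)) //= eqxx big1 ?addr0 // => k.
  by rewrite -val_eqE /= => /negPf->.
have lift0 (i : nat) (z : A) : z = 0 ->
    exists2 u : 'I_(nilindex A) -> A, (forall k, u k \in G k) /\
      (forall k : 'I_(nilindex A), (i != k.+1)%N -> u k = 0)
    & z = \sum_k u k.
  move=> ->; exists (fun=> 0); last by rewrite big1.
  by split=> // k; rewrite mem0v.
(* Products of total degree above 3 vanish, which leaves three of the nine cases to be placed by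
   [lift]. *)
case=> -[|[|i]] lti [] [|[|j]] ltj x y; rewrite /G /= => Gx Gy.
- by apply: (@lift 1%N); rewrite ?nilA //; apply: (splitting_11 spl).
- by apply: (@lift 2%N); rewrite ?nilA //; apply: (splitting_12 spl).
- by apply: lift0; apply: annM.
- by apply: (@lift 2%N); rewrite ?nilA //= mC; apply: (splitting_12 spl).
- by apply: lift0; apply: (splitting_22 spl).
- by apply: lift0; apply: annM.
- by apply: lift0; rewrite mC; apply: annM.
- by apply: lift0; rewrite mC; apply: annM.
- by apply: lift0; apply: annM.
Qed.

End ReducedGrading.

(** * Polarization *)

Section Polarization.
Variables (F : fieldType) (A : alg F).
Hypothesis charF : [pchar F] =i pred0.
Hypotheses (mA : associative (@amul F A)) (mC : commutative (@amul F A)).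
Implicit Types x y z : A.

(** In characteristic 0 the elements 0, 1, 2, ... are distinct, so a nonzero polynomial would have
    too many roots. *)
Lemma poly_eq0_of_horner (P : {poly F}) : (forall t, P.[t] = 0) -> P = 0.
Proof.
move=> P0; apply: contraTeq isT => nzP.
pose rs := [seq (i%:R : F) | i <- iota 0 (size P)].
suff : (size rs < size P)%N by rewrite size_map size_iota ltnn.
apply: max_poly_roots => //.
  by apply/allP => t _; rewrite /root P0.
rewrite map_inj_in_uniq ?iota_uniq // => i j _ _.
wlog le_ij : i j / (i <= j)%N.
  by move=> th; case/orP: (leq_total i j) => le_ij E; [|apply/esym]; apply: th.
move=> /esym/eqP; rewrite -subr_eq0 -natrB // (proj1 (pcharf0P F) charF) subn_eq0.
by move=> le_ji; apply/eqP; rewrite eqn_leq le_ij.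
Qed.

Lemma xpowS x n : xpow x n.+2 = amul x (xpow x n.+1).
Proof. by []. Qed.

Lemma xpowZ a x n : xpow (a *: x) n.+1 = a ^+ n.+1 *: xpow x n.+1.
Proof.
elim: n => [|n IH]; first by rewrite expr1.
by rewrite !xpowS IH amulZl amulZr scalerA -exprS.
Qed.

Lemma xpow_mem x n : xpow x n.+1 \in apow A n.+1.
Proof.
by elim: n => [|n IH]; [apply: memvf | rewrite xpowS apowS memv_aprodv ?memvf].
Qed.

Lemma xpow_add_ann x a n : a \in ann A -> xpow (x + a) n.+2 = xpow x n.+2.
Proof.
move=> Aa; elim: n => [|n IH]; last first.
  by rewrite xpowS IH amulDl (annP _ Aa) addr0.
by rewrite !xpowS /= amulDl (annP _ Aa) addr0 amulDr (mC x a) (annP _ Aa) addr0.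
Qed.

Lemma square_expansion (a b c t : F) :
  a + t * b + (t * b + t * (t * c)) = a + 2 * b * t + c * t * t.
Proof. ring. Qed.

Lemma xpow_line x y n (f : 'Hom(A, F^o)) : exists P : {poly F},
  [/\ forall t, f (xpow (x + t *: y) n.+2) = P.[t],
      P`_0 = f (xpow x n.+2)
    & P`_1 = n.+2%:R * f (amul (xpow x n.+1) y)].
Proof.
elim: n f => [|n IH] f.
  exists ((f (amul x x) : F)%:P + (2 * f (amul x y) : F)%:P * 'X
          + (f (amul y y) : F)%:P * 'X^2); split.
  - move=> t; rewrite !hornerE xpowS /= amulDl !amulDr !amulZl !amulZr (mC y).
    rewrite !linearD !linearZ /= /GRing.scale /=.
    move: (f (amul x x)) (f (amul x y)) (f (amul y y)) => a b c; exact: square_expansion.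
  - by rewrite !coefD !coefCM coefC coefX coefXn /= !mulr0 !addr0.
  - by rewrite !coefD !coefCM coefC coefX coefXn /= mulr0 mulr1 addr0 add0r.
have [P [PE P0 P1]] := IH (f \o linfun (amul x))%VF.
have [Q [QE Q0 Q1]] := IH (f \o linfun (amul y))%VF.
exists (P + Q * 'X); split.
- move=> t; rewrite hornerD hornerMX -PE -QE !comp_lfunE !lfunE /=.
  by rewrite xpowS amulDl amulZl linearD linearZ /= mulrC.
- by rewrite coefD coefMX /= addr0 P0 comp_lfunE lfunE.
- rewrite coefD coefMX /= P1 Q0 !comp_lfunE !lfunE /=.
  rewrite -(mC _ y) mA -[X in _ + X]mul1r -mulrDl -(natrD _ _ 1) addn1.
  by rewrite -xpowS.
Qed.

(** After composition with a linear form, the hypothesis along a line says that a polynomial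
    vanishes everywhere; its linear coefficient is 0, and n.+2 can be divided out. *)
Lemma xpow_derive n (L : 'Hom(A, A)) : (forall x, L (xpow x n.+2) = 0) ->
  forall x y, L (amul (xpow x n.+1) y) = 0.
Proof.
move=> L0 x y; apply/eqP; rewrite -memv0; apply/negPn/negP.
case/linear_form_separates=> g _ gv.
have [P [PE _ P1]] := xpow_line x y n (g \o L)%VF.
have P0 : P = 0.
  by apply: poly_eq0_of_horner => t; rewrite -PE comp_lfunE L0 linear0.
move/eqP: P1; rewrite P0 coef0 comp_lfunE gv mulr1 eq_sym.
by rewrite (negPf (char0_natr_neq0 charF _)).
Qed.

(* Polarization, one variable at a time: x^(n+2-j) A^j = 0 for all j.         *)
Lemma xpow_eq0_apow n : (forall x, xpow x n.+2 = 0) -> apow A n.+2 = 0%VS.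
Proof.
move=> x0; suff H j : (j <= n)%N ->
    forall x z, z \in apow A j.+1 -> amul (xpow x (n - j).+1) z = 0.
  apply/eqP; rewrite -subv0 apowS; apply/aprodvP => x z _ Az.
  by have := H n (leqnn n) x z Az; rewrite subnn memv0 => /= ->.
elim: j => [_ x z _|j IH lt_jn x z].
  rewrite subn0; have := @xpow_derive n \1%VF _ x z; rewrite id_lfunE; apply.
  by move=> x'; rewrite id_lfunE x0.
pose m := (n - j.+1)%N; have mE : (n - j)%N = m.+1 by rewrite /m subnSK.
have IH' x' z' : z' \in apow A j.+1 -> amul (xpow x' m.+2) z' = 0.
  by move=> Az'; rewrite -mE IH // ltnW.
suff : (apow A j.+2 <= lker (linfun (amul (xpow x m.+1))))%VS.
  by move=> /subvP s Az; have := s z Az; rewrite memv_ker lfunE => /eqP.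
rewrite apowS; apply/aprodvP => y z' _ Az'; rewrite memv_ker lfunE /= mA.
(* Differentiating x^(m+2) z' = 0 in the direction y, with multiplication by z' as the linear map,
   gives x^(m+1) y z' = 0. *)
apply/eqP; have := @xpow_derive m (linfun (applyr amul z')) _ x y.
by rewrite lfunE; apply=> x'; rewrite lfunE; apply: IH'.
Qed.

End Polarization.

(** * Type (C) forces nil-index three *)

Section TypeCNilindex.
Variables (F : fieldType) (A : alg F).
Hypothesis charF : [pchar F] =i pred0.

Lemma nil_polynomial_cubic (W : vectType F) (p : W -> F) :
    admissible A -> nil_polynomial A p ->
    (forall x, exists a b, forall t, p (t *: x) = t ^+ 2 * a + t ^+ 3 * b) ->
  (nilindex A <= 3)%N.
Proof.
move=> admA [w [phi [pw _ phiW pE]]] pcub; have [mA mC nA dA] := admA.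
rewrite leqNgt; apply/negP => lt3; set nu := nilindex A in lt3 *.
have wpow x : w (xpow (phi x) nu) = 0.
  have [a [b pab]] := pcub x.
  (* The coefficient of t^k in [p (t *: x)]; it is 0 for k < 2 because [exp2] starts at k = 2. *)
  pose e k : F := if (1 < k)%N then k`!%:R^-1 * w (xpow (phi x) k) else 0.
  pose P : {poly F} := \poly_(k < nu.+1) e k - (a *: 'X^2 + b *: 'X^3).
  have P0 : P = 0.
    apply: poly_eq0_of_horner => // t; rewrite hornerD hornerN hornerD !hornerZ.
    rewrite !hornerXn horner_poly (mulrC a) (mulrC b) -pab pE.
    apply/eqP; rewrite subr_eq0; apply/eqP.
    rewrite -(big_mkord xpredT (fun k => e k * t ^+ k)).
    have lt1 : (1 < nu.+1)%N by rewrite ltnS (leq_trans _ lt3).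
    rewrite big_ltn // (big_ltn lt1) {1 2}/e !mul0r !add0r.
    rewrite /exp2 linearZ linear_sum big_nat [RHS]big_nat.
    apply: eq_bigr => -[|[|k]] // _; rewrite xpowZ !linearZ /e ltnS.
    by rewrite -mulrA (mulrC _ (t ^+ _)).
  (* Since nu > 3, the cubic expression has no term of degree nu, so [e nu] is 0. *)
  have := congr1 (fun Q : {poly F} => Q`_nu) P0.
  rewrite /P coefB coefD coefZ coefZ !coefXn coef_poly coef0 ltnSn.
  rewrite (gtn_eqF lt3) (gtn_eqF (ltnW lt3)) !mulr0 addr0 subr0 => /eqP.
  rewrite /e (ltnW (ltnW lt3)).
  have := char0_natr_neq0 charF (nu`!.-1); rewrite prednK ?fact_gt0 // => f0.
  by rewrite mulf_eq0 invr_eq0 (negPf f0) => /eqP.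
have [n nuE] : exists n, nu = n.+2 by exists nu.-2; move: lt3; case: (nu) => [|[|]].
(* Powers from the second on ignore summands from Ann A, so x may be moved into [lker w]; and x^nu
   lies in A^nu = Ann A, where [w] is injective. *)
have xpow0 (x : A) : xpow x n.+2 = 0.
  have [a Aa xa] := pointing_decomp pw x.
  rewrite -(subrK a x) xpow_add_ann //; apply: (pointing_ann_inj admA pw).
    by rewrite -(apow_top admA) -/nu nuE xpow_mem.
  by move: xa; rewrite -phiW => /memv_imgP[u _ ->]; rewrite -nuE.
have := apow_top admA; rewrite -/nu nuE (xpow_eq0_apow charF mA mC xpow0) => A0.
by move: dA; rewrite -A0 dimv0.
Qed.

(** The nil-polynomial bounds the nil-index by 3, the dimension excludes 1, and reducedness excludes
    2. *)
Lemma typeC_nilindex : typeC A -> nilindex A = 3%N.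
Proof.
case=> redA dimA [W [W1 [W2 [q [c [p [[_ dxW WE] [q2 _ _ _] c3 pE nilp]]]]]]].
have admA := proj1 redA.
have le3 : (nilindex A <= 3)%N.
  apply: nil_polynomial_cubic admA nilp _ => x.
  have : x \in (W1 + W2)%VS by rewrite WE memvf.
  case/memv_addP=> x1 W1x [x2 W2x ->].
  exists (q (x1 + x2)), (c (vsproj W1 x1)) => t.
  rewrite -(is_form_homogeneous _ _ q2) -(is_form_homogeneous _ _ c3).
  have := pE (t *: vsproj W1 x1) (t *: vsproj W2 x2).
  by rewrite ![vsval _]linearZ /= !vsprojK // -scalerDr => ->.
have gt1 : (1 < nilindex A)%N.
  rewrite ltnNge; apply/negP => /(nilindex_le1P admA) A1.
  by rewrite A1 in dimA.
have neq2 := reduced_nilindex_neq2 redA.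
by move: le3 gt1 neq2; case: (nilindex A) => [|[|[|[|]]]].
Qed.

End TypeCNilindex.

(** * From the factors to the smash product, and its Hilbert function *)

Section SmashAdmissible.
Variable F : fieldType.
Implicit Types A B N : alg F.

Lemma smash_associative_commutative A B (wA : 'Hom(A, F^o)) (wB : 'Hom(B, F^o)) :
    admissible A -> admissible B ->
  associative (@amul F (smash wA wB)) /\ commutative (@amul F (smash wA wB)).
Proof.
move=> admA admB; have [mA cA _ _] := admA; have [mB cB _ _] := admB.
split=> [u v t|u v].
  rewrite -[u]vclsK -[v]vclsK -[t]vclsK !(smash_cls_mul _ _ admA admB).
  by congr (vcls _ _); congr (_, _); rewrite /= ?mA ?mB.
rewrite -[u]vclsK -[v]vclsK !(smash_cls_mul _ _ admA admB).
by congr (vcls _ _); congr (_, _); rewrite /= ?(cA (vrepr u).1) ?(cB (vrepr u).2).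
Qed.

Lemma smash_admissible A B N (wA : 'Hom(A, F^o)) (wB : 'Hom(B, F^o)) :
    admissible A -> admissible B -> pointing wA -> pointing wB ->
    isomorphic N (smash wA wB) ->
  admissible N.
Proof.
move=> admA admB pA pB iso; have [f [g fg]] := isomorphic_smash_internal admA admB pA pB iso.
have [mS cS] := smash_associative_commutative wA wB admA admB.
have [h [bh hM]] := iso; have Eh : alg_embedding h by split; first exact: bij_lker0.
have cN := alg_embedding_comm Eh cS.
have [[[f0 _] _] _ _ _ _] := fg.
have [_ _ [k Ak] dA] := admA; have [_ _ [l Bl] _] := admB.
split=> //; first exact: alg_embedding_assoc Eh mS.
  exists (maxn k l); rewrite (internal_smash_apow fg cN).
  have -> : apow A (maxn k l).+1 = 0%VS.
    by apply/eqP; rewrite -subv0 -Ak apow_sub // ltnS leq_maxl.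
  have -> : apow B (maxn k l).+1 = 0%VS.
    by apply/eqP; rewrite -subv0 -Bl apow_sub // ltnS leq_maxr.
  by rewrite !limg0 addv0.
by rewrite (internal_smash_ann fg cN) lker0_dim.
Qed.

Section InternalNilindex.
Variables (A B N : alg F) (f : 'Hom(A, N)) (g : 'Hom(B, N)).
Hypotheses (admA : admissible A) (admB : admissible B) (admN : admissible N).
Hypotheses (nilB : (nilindex B <= 2)%N) (fg : internal_smash f g).

Let cN : commutative (@amul F N). Proof. by case: admN. Qed.
Let f0 : lker f = 0%VS. Proof. by case: fg => [[[]]]. Qed.

Let B3 : apow B 3 = 0%VS.
Proof. by apply/nilindex_leP => //; case: admB. Qed.

(** Since B^3 = 0, the third and later powers of N are the images of those of A. *)
Lemma internal_smash_nilindex3 : nilindex A = 3%N <-> nilindex N = 3%N.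
Proof.
have N3 k : apow N k.+3 = (f @: apow A k.+3)%VS.
  rewrite (internal_smash_apow fg cN k.+2).
  have -> : apow B k.+3 = 0%VS by apply/eqP; rewrite -subv0 -B3 apow_sub.
  by rewrite limg0 addv0.
have eq0 k : apow N k.+3 = 0%VS <-> apow A k.+3 = 0%VS.
  rewrite N3; split=> [/eqP|->]; last by rewrite limg0.
  by rewrite -dimv_eq0 lker0_dim // dimv_eq0 => /eqP.
have [_ _ nA _] := admA; have [_ _ nN _] := admN.
split=> nil3.
  have [A4 _] := nilindexP nA; rewrite nil3 in A4.
  apply: nilindex_eq; first exact/eq0.
  by apply/eqP => /eq0/(nilindex_leP _ nA); rewrite nil3.
have [N4 _] := nilindexP nN; rewrite nil3 in N4.
apply: nilindex_eq; first exact/eq0.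
by apply/eqP => /eq0/(nilindex_leP _ nN); rewrite nil3.
Qed.

(** g(B^2) adds nothing: B^2 lies in Ann B, whose image is that of Ann A, and Ann A = A^3 lies in
    A^2. *)
Lemma internal_smash_square : nilindex A = 3%N -> apow N 2 = (f @: apow A 2)%VS.
Proof.
move=> nilA; rewrite (internal_smash_apow fg cN 1); apply/addv_idPl.
apply: subv_trans (limgS f (nil3_ann_sub admA nilA)).
rewrite (internal_smash_ann_eq fg); apply: limgS; apply/subvP => x Bx.
have [_ cB _ _] := admB; apply/annP => y; apply/eqP.
by rewrite cB -memv0 -B3 apowS memv_aprodv ?memvf.
Qed.

End InternalNilindex.

Lemma hilbert_nilindex_le2 A : admissible A -> (nilindex A <= 2)%N ->
  [/\ (1 < \dim {:A})%N -> hilbert A = [:: 1; \dim {:A} - 1; 1]%N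
    & \dim {:A} = 1%N -> hilbert A = [:: 1; 1]%N].
Proof.
move=> admA le2; have [_ _ nA _] := admA; have gt0 := admissible_nilindex_gt0 admA.
split=> dimA.
  apply: hilbert_nil2 => //; apply/eqP; rewrite eqn_leq le2 ltnNge.
  by apply/negP => /(nilindex_le1P admA) A1; rewrite A1 in dimA.
have /(nilindex_le1P admA) le1 := dimA.
by rewrite hilbert_nil1 ?dimA //; apply/eqP; rewrite eqn_leq le1.
Qed.

Lemma hilbert_dim1 A : admissible A -> hilbert A = [:: 1; 1]%N -> \dim {:A} = 1%N.
Proof.
move=> admA /(congr1 size); rewrite size_mkseq => -[nil1].
by apply/(nilindex_le1P admA); rewrite nil1.
Qed.

Lemma hilbert_symmetric_nil3 A n : nilindex A = 3%N ->
  hilbert A = [:: 1; n; n; 1]%N -> hilbert_symmetric A.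
Proof.
move=> nil3 hA k le_k.
have hE j : (j < 4)%N -> hilbert_fun A j = nth 0%N [:: 1; n; n; 1]%N j.
  by move=> lt_j; rewrite -hA nth_mkseq // nil3.
rewrite !hE ?nil3 ?ltnS ?leq_subr //; last by rewrite -nil3.
by move: le_k; rewrite nil3; case: k => [|[|[|[|]]]].
Qed.

End SmashAdmissible.

Theorem mainTheorem10 (F : fieldType) (charF : [pchar F] =i pred0) :
  (forall N : alg F,
     (admissible N /\ nilindex N = 3%N) <->
     (exists (N' N'' : alg F) (w' : 'Hom(N', F^o)) (w'' : 'Hom(N'', F^o)),
        [/\ typeC N' /\ pointing w',
            admissible N'' /\ pointing w'',
            (nilindex N'' <= 2)%N
          & isomorphic N (smash w' w'')])) /\
  (forall (N N' N'' : alg F) (w' : 'Hom(N', F^o)) (w'' : 'Hom(N'', F^o))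
          (m n : nat),
     admissible N -> nilindex N = 3%N ->
     typeC N' -> pointing w' ->
     admissible N'' -> pointing w'' -> (nilindex N'' <= 2)%N ->
     isomorphic N (smash w' w'') ->
     hilbert N = [:: 1; m; n; 1]%N ->
     [/\ hilbert N' = [:: 1; n; n; 1]%N /\ hilbert_symmetric N',
         exists G : 'I_(nilindex N') -> {vspace N'}, canonical_grading G,
         (n <= m)%N,
         (n < m)%N -> hilbert N'' = [:: 1; m - n; 1]%N
       & [/\ m = n -> hilbert N'' = [:: 1; 1]%N,
             hilbert N'' = [:: 1; 1]%N <-> \dim {:N''} = 1%N
           & \dim {:N''} = 1%N <-> isomorphic N N']]).
Proof.
have char2 := char0_natr_neq0 charF 1; split=> [N|].
  split=> [[admN nilN]|[A [B [wA [wB [[typeA pA] [admB pB] nilB iso]]]]]].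
    have [A [B [wA [wB [[redA nilA pA] ? ? ?]]]]] := nil3_decomposition char2 admN nilN.
    by exists A, B, wA, wB; split=> //; split=> //; apply: reduced_nil3_typeC.
  have admA : admissible A by case: typeA => -[].
  have admN := smash_admissible admA admB pA pB iso.
  have [f [g fg]] := isomorphic_smash_internal admA admB pA pB iso.
  split=> //; apply/(internal_smash_nilindex3 admA admB admN nilB fg).
  exact: typeC_nilindex.
move=> N A B wA wB m n admN nilN typeA pA admB pB nilB iso hN.
have redA : reduced A by case: typeA.
have admA := proj1 redA; have nilA := typeC_nilindex charF typeA.
have [f [g fg]] := isomorphic_smash_internal admA admB pA pB iso.
have [[[f0 _] _] _ _ _ _] := fg.
have dimN := internal_smash_dim admA fg.
have dimA := reduced_nil3_dim char2 redA nilA.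
have sqN := internal_smash_square admA admB admN nilB fg nilA.
have gt0B : (0 < \dim {:B})%N.
  by have [_ _ _ <-] := admB; apply: dimvS; apply: subvf.
have gt0A : (0 < \dim {:A})%N.
  by have [_ _ _ <-] := admA; apply: dimvS; apply: subvf.
have [hB2 hB1] := hilbert_nilindex_le2 admB nilB.
move: hN; rewrite (hilbert_nil3 admN nilN) sqN lker0_dim //.
have := hilbert_nil3 admA nilA.
(* Here e = n + 1, so dim A = 2n + 1 and dim B = m - n + 1; as [B] is nonzero, n <= m, and the
   numerical claims become arithmetic. *)
move: dimN dimA; set e := \dim (apow A 2) => dimN dimA hA [mE nE].
have hA' : hilbert A = [:: 1; n; n; 1]%N.
  by rewrite hA nE; do 2!congr (_ :: _); lia.
split.
- by split=> //; apply: hilbert_symmetric_nil3 hA'.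
- exact: reduced_nil3_canonical_grading.
- lia.
- by move=> lt_nm; rewrite hB2; [do 2!congr (_ :: _); lia | lia].
split.
- by move=> eq_mn; apply: hB1; lia.
- by split; [apply: hilbert_dim1 | apply: hB1].
- split=> [B1|/isomorphic_dim isoNA]; last by lia.
  exact: nilindex_le1_isomorphic admB fg B1.
Qed.
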